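(* There is a non-affine increasing $C^{1,1}$ diffeomorphism $f:\mathbb R\to\mathbb R$ such that $$f(\mathcal N_b)\subseteq\mathcal N_b\quad\text{for every integer }b\ge2 .$$ In particular, the same map satisfies $f(\mathcal N)\subseteq\mathcal N$. Both $f$ and $f^{-1}$ have globally Lipschitz derivatives.
   Context: For an integer base $b\ge2$ and $x\in\mathbb R$, use the canonical base-$b$ expansion of the fractional part of $x$ (choosing the terminating expansion when there are two choices). $x$ is $b$-normal if every finite word $w$ over $\{0,\dots,b-1\}$ occurs in this digit sequence with asymptotic frequency $b^{-|w|}$. $\mathcal N_b$ is the set of $b$-normal real numbers, and $\mathcal N=\bigcap_{b\ge2}\mathcal N_b$ is the set of absolutely normal numbers. A $C^{1,1}$ function is a continuously differentiable function with a Lipschitz derivative. Non-affine means not of the form $x\mapsto ax+c$ on $\mathbb R$. *)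

(* Defs.v *)
From HB Require Import structures.
From mathcomp Require Import all_boot all_order all_algebra.
From mathcomp Require Import all_classical all_reals all_analysis.
Set Implicit Arguments.
Unset Strict Implicit.
Unset Printing Implicit Defensive.
Import Order.TTheory GRing.Theory Num.Theory.
Import numFieldNormedType.Exports.
Local Open Scope ring_scope.
Local Open Scope classical_set_scope.

Definition frac_part (R : realType) (x : R) : R := x - (Num.floor x)%:~R.

(* Positions start at 0: [digit b x 0] is the first digit after the radix
   point.  For b >= 2 the floor yields the terminating expansion whenever
   there are two: by [digit_expansion] every remainder after n digits is
   strictly below b^-n, so the digits are not eventually all equal to b - 1. *)
Definition digit (R : realType) (b : nat) (x : R) (k : nat) : nat :=
  (Num.truncn (b%:R ^+ k.+1 * frac_part x) %% b)%N.

Lemma frac_part_ge0 (R : realType) (x : R) : 0 <= frac_part x.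
Proof. by rewrite subr_ge0 floor_le. Qed.

Lemma frac_part_lt1 (R : realType) (x : R) : frac_part x < 1.
Proof. by rewrite ltrBlDl addrC; have := floorD1_gt x; rewrite intrD addrC. Qed.

Lemma digit_lt (R : realType) (b : nat) (x : R) (k : nat) :
  (0 < b)%N -> (digit b x k < b)%N.
Proof. exact: ltn_pmod. Qed.

Lemma digit_expansion (R : realType) (b : nat) (x : R) (n : nat) :
  (0 < b)%N ->
  0 <= frac_part x - \sum_(i < n) (digit b x i)%:R / b%:R ^+ i.+1 < b%:R ^- n.
Proof.
move=> b0; have bR : 0 < b%:R :> R by rewrite ltr0n.
have y0 m : 0 <= b%:R ^+ m * frac_part x :> R.
  by rewrite mulr_ge0 ?exprn_ge0 ?frac_part_ge0// ltW.
have E : \sum_(i < n) (digit b x i)%:R / b%:R ^+ i.+1 =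
    (Num.truncn (b%:R ^+ n * frac_part x))%:R / b%:R ^+ n :> R.
  elim: n => [|n IH].
    rewrite big_ord0 expr0 mul1r (_ : Num.truncn _ = 0%N) ?mul0r//.
    by apply: truncn_def; rewrite frac_part_ge0 frac_part_lt1.
  rewrite big_ord_recr /= IH /digit.
  set t := Num.truncn (b%:R ^+ n.+1 * _).
  have -> : Num.truncn (b%:R ^+ n * frac_part x) = (t %/ b)%N.
    apply: truncn_def; have /andP[t1 t2] := truncn_itv (y0 n.+1).
    rewrite -(ler_pM2l bR) -(ltr_pM2l bR) mulrA -exprS -!natrM.
    apply/andP; split.
      by apply: le_trans t1; rewrite ler_nat mulnC leq_divM.
    by apply: lt_le_trans t2 _; rewrite ler_nat mulnC ltn_ceil.
  rewrite {3}(divn_eq t b) natrD natrM mulrDl; congr (_ + _).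
  by rewrite exprS invfM mulrA mulfK// gt_eqF.
have /andP[t1 t2] := truncn_itv (y0 n).
have bn : 0 < b%:R ^+ n :> R by rewrite exprn_gt0.
rewrite E subr_ge0 ler_pdivrMr// [frac_part x * _]mulrC t1 /= ltrBlDl.
by rewrite -[X in _ + X]mul1r -mulrDl ltr_pdivlMr// natr1 mulrC.
Qed.

(* The number of occurrences, overlaps included, of the word w starting at one
   of the first n positions. *)
Definition word_count (R : realType) (b : nat) (x : R) (w : seq 'I_b)
    (n : nat) : nat :=
  count (fun i => [seq digit b x j | j <- iota i (size w)] == map val w)
    (iota 0 n).

Definition normal_numbers (R : realType) (b : nat) : set R :=
  [set x | forall w : seq 'I_b,
    (word_count x w n)%:R / n%:R @[n --> \oo] --> (b%:R ^- size w : R)].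
Arguments normal_numbers : clear implicits.

Definition absolutely_normal_numbers (R : realType) : set R :=
  \bigcap_(b in [set b | (2 <= b)%N]) normal_numbers R b.
Arguments absolutely_normal_numbers : clear implicits.

Definition C11 (R : realType) (f : R -> R) : Prop :=
  [/\ forall x, derivable f x 1, continuous f^`() & lipschitz f^`()].

Definition affine (R : realType) (f : R -> R) : Prop :=
  exists a c : R, forall x, f x = a * x + c.

(* Main.v *)
Require Import Defs.
From mathcomp Require Import all_boot all_order all_algebra.
From mathcomp Require Import all_classical all_reals all_analysis.
From mathcomp Require Import zify ring lra.
Set Implicit Arguments.
Unset Strict Implicit.
Unset Printing Implicit Defensive.
Import Order.TTheory GRing.Theory Num.Theory.
Import numFieldNormedType.Exports.
Local Open Scope ring_scope.
Local Open Scope classical_set_scope.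

(** A Lipschitz derivative that is constant off a null set is constant, so the
derivative of the map must vary on a set of positive measure.  The way out is to
let it vary only where the image is normal to every base anyway.  It is the
inverse [h] that is constructed, rather than [f].  By Borel's theorem and outer
regularity there is a closed set [K] in [[0, 1]] of positive measure all of whose
points, except possibly 1, are absolutely normal.  The map [h] is built so that
its derivative is constant on each component of the complement of [K], and so that
[h y = a * y + c] there, with [a > 0] and [c] rational depending on the component
only.  If [x = h y] is normal to base [b], then either [y] lies in [K] and is
normal by the choice of [K], or [y] is the image of [x] under a rational affine
map, which preserves normality by Wall's theorem.

The set [K] enters through [m y], the measure of the part of [K] below [y], a
nondecreasing 1-Lipschitz function that is locally constant off [K]
([exists_staircase]).  The map is [h y = y + U y] with [U' = u], where the
oscillation of [u] is dominated by that of [m]; hence [u] is Lipschitz and locally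
constant off [K].  It remains to make [u] and [U] rational at the rational points
of [[0, 1]]: every gap of [K] contains such a point [d], or has [d = 1] as an end
point, so on the gap [h] is the affine map with slope [1 + u d] through the
rational point [(d, h d)].  These are countably many conditions, met one rational
at a time
([exists_rational_profile]).  At each step, between the two nearest points
treated before, one adds small multiples of two functions, one adjusting [u d]
and the other adjusting [U d] alone; both leave the earlier values untouched.
Choosing the multiples summable makes the process converge.

Both facts on normal numbers rest on the criterion of Piatetski-Shapiro
([hot_spot]): if there is a [C] such that, for every [k], each word of length [k]
has upper frequency at most [C * b ^- k], then the number is normal.  For rational
affine images it is enough to observe that, whenever a given word occurs in [y],
one of a bounded number of words occurs at the same place in [x]
([normal_affine]).  For Borel's theorem a crude Chebyshev bound along powers of
two suffices ([negligible_not_normal]).  The criterion and the Chebyshev bound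
share a single second-moment estimate ([sum_count_dev_sqr]).

A word of length [k] is handled through the integer below [b ^ k] that it
represents, so that combinatorics on words becomes division with remainder. *)

(** * Second moment of the number of occurrences of a block *)

(** The [k] base-[b] digits of [v] starting at the digit of weight [b ^ s], read
as one integer. *)
Definition block (b v s k : nat) : nat := ((v %/ b ^ s) %% b ^ k)%N.

Definition block_dev (F : realFieldType) (b k c s v : nat) : F :=
  (block b v s k == c)%:R - b%:R ^- k.

Lemma sum_ord_mul (V : nmodType) (m n : nat) (F : nat -> V) :
  \sum_(v < m * n) F v = \sum_(q < m) \sum_(r < n) F (q * n + r)%N.
Proof.
rewrite -(big_mkord xpredT F) big_nat_mul big_mkord.
apply: eq_bigr => q _.
rewrite -{1}[(q * n)%N]add0n big_addn mulSn addnK big_mkord.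
by apply: eq_bigr => r _; rewrite addnC.
Qed.

Lemma blockDl (b q r s k t : nat) : (0 < b)%N -> (s + k <= t)%N ->
  block b (q * b ^ t + r) s k = block b r s k.
Proof.
move=> b0 skt; rewrite /block -(subnK skt) [(s + k)%N]addnC !expnD !mulnA.
by rewrite divnMDl ?expn_gt0 ?b0// modnMDl.
Qed.

Lemma blockDr (b q r s k t : nat) : (0 < b)%N -> (t <= s)%N -> (r < b ^ t)%N ->
  block b (q * b ^ t + r) s k = block b q (s - t) k.
Proof.
move=> b0 ts rt; rewrite /block -{1}(subnKC ts) expnD divnMA.
by rewrite divnMDl ?expn_gt0 ?b0// (divn_small rt) addn0.
Qed.

(** Each value below [b ^ k] is taken equally often by a block of digits lying
inside a complete range of integers. *)
Lemma sum_block_dev (F : realFieldType) (b k c s t : nat) :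
  (0 < b)%N -> (c < b ^ k)%N -> (s + k <= t)%N ->
  \sum_(v < b ^ t) block_dev F b k c s v = 0.
Proof.
move=> b0 cb skt.
have bk0 : b%:R ^+ k != 0 :> F by rewrite expf_neq0// pnatr_eq0 -lt0n.
rewrite -(subnK skt) expnD (sum_ord_mul _ _ (block_dev F b k c s)).
apply: big1 => q _.
under eq_bigr do rewrite /block_dev blockDl//.
rewrite addnC expnD.
rewrite (sum_ord_mul _ _ (fun r => (block b r s k == c)%:R - b%:R ^- k : F)).
under eq_bigr => i _.
  under eq_bigr => j _.
    rewrite blockDr// subnn /block expn0 divn1 modn_small//.
    over.
  rewrite sumr_const card_ord.
  over.
rewrite /= sumrMnl sumrB sumr_const card_ord.
rewrite (bigD1 (Ordinal cb)) //= eqxx big1; last first.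
  by move=> i /negPf; rewrite -val_eqE /= => ->.
by rewrite addr0 -[_ *+ (b ^ k)]mulr_natr natrX mulVf// subrr mul0rn.
Qed.

(** Disjoint blocks are independent under the uniform distribution: splitting [v]
at the digit [s'], the upper part determines one factor and the lower part the
other, whose sum over the lower part vanishes. *)
Lemma block_dev_orthogonal (F : realFieldType) (b k c s s' t : nat) :
  (0 < b)%N -> (c < b ^ k)%N -> (s + k <= s')%N -> (s' + k <= t)%N ->
  \sum_(v < b ^ t) block_dev F b k c s v * block_dev F b k c s' v = 0.
Proof.
move=> b0 cb ss' st.
have s't : (s' <= t)%N by rewrite (leq_trans _ st)// leq_addr.
rewrite -(subnK s't) expnD.
rewrite (sum_ord_mul _ _ (fun v => block_dev F b k c s v * block_dev F b k c s' v)).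
apply: big1 => q _.
under eq_bigr => r _.
  rewrite /block_dev blockDl// blockDr// subnn.
  over.
by rewrite -mulr_suml (@sum_block_dev F b k c s s')// mul0r.
Qed.

Lemma block_dev_le1 (F : realFieldType) (b k c s v : nat) : (0 < b)%N ->
  `|block_dev F b k c s v| <= 1.
Proof.
move=> b0; rewrite /block_dev.
have p0 : 0 <= b%:R ^- k :> F by rewrite invr_ge0 exprn_ge0.
have p1 : b%:R ^- k <= 1 :> F.
  by rewrite invf_le1 ?exprn_gt0 ?ltr0n// exprn_ege1// ler1n.
move: (b%:R ^- k) p0 p1 => p p0 p1.
by case: (_ == _); rewrite ?mulr1n ?mulr0n ler_norml; lra.
Qed.

Lemma sum_near_le (s k L : nat) :
  (\sum_(s' < L) ((s < s' + k) && (s' < s + k))%N <= 2 * k)%N.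
Proof.
rewrite -(big_mkord xpredT (fun s' => ((s < s' + k) && (s' < s + k))%N : nat)).
rewrite /index_iota subn0.
have -> : (\sum_(i <- iota 0 L) (((s < i + k) && (i < s + k))%N) =
           count (fun i => ((s < i + k) && (i < s + k))%N) (iota 0 L))%N.
  rewrite -sum1_count [RHS]big_mkcond /=.
  by apply: eq_bigr => i _; case: (_ && _).
rewrite -size_filter -[leqRHS](size_iota (s - k)).
apply: uniq_leq_size; first by rewrite filter_uniq// iota_uniq.
by move=> i; rewrite mem_filter !mem_iota; lia.
Qed.

Definition count_dev (F : realFieldType) (b k c L v : nat) : F :=
  \sum_(s < L) block_dev F b k c s v.

(** In the expansion of the square only the pairs of positions at distance less
than [k] survive, at most [2 * k] for each position, and each contributes at most
one per integer [v]. *)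
Lemma sum_count_dev_sqr (F : realFieldType) (b k c L : nat) :
  (0 < b)%N -> (c < b ^ k)%N ->
  \sum_(v < b ^ (L + k)) count_dev F b k c L v ^+ 2 <=
    (2 * k * L * b ^ (L + k))%:R.
Proof.
move=> b0 cb; rewrite /count_dev.
under eq_bigr => v _.
  rewrite expr2 mulr_suml.
  under eq_bigr do rewrite mulr_sumr.
  over.
rewrite exchange_big /=.
under eq_bigr do rewrite exchange_big /=.
apply: (@le_trans _ _ (\sum_(s < L) \sum_(s' < L)
    (((s < s' + k) && (s' < s + k))%N * b ^ (L + k))%:R)).
  apply: ler_sum => s _; apply: ler_sum => s' _.
  case: (ltnP s (s' + k)) => [h1|h1] /=; last first.
    rewrite (_ : \sum_(i < _) _ = 0) ?ler0n//.
    under eq_bigr do rewrite mulrC.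
    by apply: block_dev_orthogonal => //; rewrite leq_add2r ltnW.
  case: (ltnP s' (s + k)) => [h2|h2] /=; last first.
    rewrite (_ : \sum_(i < _) _ = 0) ?ler0n//.
    by apply: block_dev_orthogonal => //; rewrite leq_add2r ltnW.
  rewrite mul1n -[leRHS]mulr1 mulr_natl -[X in _ *+ X]card_ord -sumr_const.
  apply: ler_sum => v _; apply: le_trans (ler_norm _) _.
  by rewrite normrM mulr_ile1// block_dev_le1.
under eq_bigr do rewrite -natr_sum -big_distrl /=.
rewrite -natr_sum -big_distrl /= ler_nat leq_mul2r; apply/orP; right.
rewrite mulnC -[X in (_ <= X * _)%N]card_ord -sum_nat_const.
by apply: leq_sum => s _; apply: sum_near_le.
Qed.

(** * Expansions read as integers *)

(** The integer formed by the first [n] digits. *)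
Definition digit_prefix (R : realType) (b : nat) (x : R) (n : nat) : nat :=
  Num.truncn (b%:R ^+ n * frac_part x).

Definition digit_block (R : realType) (b : nat) (x : R) (i k : nat) : nat :=
  (digit_prefix b x (i + k) %% b ^ k)%N.

Definition block_count (R : realType) (b : nat) (x : R) (k c n : nat) : nat :=
  \sum_(i < n) (digit_block b x i k == c).

Lemma digit_prefix_divn (R : realType) (b : nat) (x : R) (n s : nat) :
  (0 < b)%N -> (digit_prefix b x (n + s) %/ b ^ s)%N = digit_prefix b x n.
Proof.
move=> b0; have y0 : 0 <= b%:R ^+ (n + s) * frac_part x :> R.
  by rewrite mulr_ge0 ?exprn_ge0 ?frac_part_ge0.
have bs0 : 0 < (b ^ s)%:R :> R by rewrite ltr0n expn_gt0 b0.
apply/esym/truncn_def; have /andP[t1 t2] := truncn_itv y0.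
have E : b%:R ^+ (n + s) * frac_part x = (b ^ s)%:R * (b%:R ^+ n * frac_part x).
  by rewrite natrX mulrA -exprD addnC.
rewrite -(ler_pM2l bs0) -(ltr_pM2l bs0) -E -!natrM; apply/andP; split.
  by apply: le_trans t1; rewrite ler_nat mulnC leq_divM.
by apply: lt_le_trans t2 _; rewrite ler_nat mulnC ltn_ceil ?expn_gt0 ?b0.
Qed.

Lemma digit_prefix_lt (R : realType) (b : nat) (x : R) (n : nat) :
  (0 < b)%N -> (digit_prefix b x n < b ^ n)%N.
Proof.
move=> b0; have bn0 : (0 < b ^ n)%N by rewrite expn_gt0 b0.
rewrite -[X in (_ < X)%N]mul1n -ltn_divLR// -[n in digit_prefix _ _ n]add0n.
rewrite digit_prefix_divn// /digit_prefix expr0 mul1r.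
by rewrite (_ : Num.truncn _ = 0%N)//; apply: truncn_def; rewrite frac_part_ge0 frac_part_lt1.
Qed.

(** A block inside a window of the expansion is a block of the expansion.  Windows
are indexed from the left, digits of an integer from the right; this is why the
two offsets add up to the length of the window. *)
Lemma block_digit_block (R : realType) (b : nat) (x : R) (i j s k : nat) :
  (0 < b)%N ->
  block b (digit_block b x i (j + k + s)) s k = digit_block b x (i + j) k.
Proof.
move=> b0; rewrite /block /digit_block.
rewrite -(digit_prefix_divn x (i + j + k) s b0) !addnA.
move: (digit_prefix _ _ _) => v.
set r := (v %% _)%N; rewrite [in RHS](divn_eq v (b ^ (j + k + s))) -/r.
rewrite [X in (_ * X + r)%N]expnD mulnA divnMDl ?expn_gt0 ?b0//.
by rewrite (expnD b j) mulnA modnMDl.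
Qed.

Definition word_value (b : nat) (w : seq nat) : nat :=
  foldl (fun v d => v * b + d)%N 0%N w.

Lemma word_value_lt (b : nat) (w : seq nat) : all (fun d => d < b)%N w ->
  (word_value b w < b ^ size w)%N.
Proof.
elim/last_ind: w => [//|w d IH]; rewrite all_rcons => /andP[db wb].
rewrite /word_value foldl_rcons size_rcons expnSr.
have := IH wb; rewrite -/(word_value b w); nia.
Qed.

Lemma digit_block_word (R : realType) (b : nat) (x : R) (i : nat) (w : seq nat) :
  (0 < b)%N -> all (fun d => d < b)%N w ->
  ([seq digit b x j | j <- iota i (size w)] == w) =
  (digit_block b x i (size w) == word_value b w).
Proof.
move=> b0; elim/last_ind: w => [|w d IH].
  by rewrite /= /digit_block expn0 modn1.
rewrite all_rcons => /andP[db wb].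
rewrite size_rcons -addn1 iotaD map_cat /= cats1 eqseq_rcons IH//.
rewrite /word_value foldl_rcons -/(word_value b w).
have -> : digit_block b x i (size w + 1) =
    (digit_block b x i (size w) * b + digit b x (i + size w))%N.
  rewrite /digit_block -(digit_prefix_divn x (i + size w) 1 b0) expn1 -addnA.
  rewrite /digit -/(digit_prefix b x (i + size w).+1) -(addn1 (i + size w)) -addnA.
  move: (digit_prefix b x _) => v.
  rewrite {1}(divn_eq v b) {1}(divn_eq (v %/ b) (b ^ size w)).
  rewrite mulnDl -mulnA -expnSr -addnA addn1 modnMDl modn_small//.
  by have := ltn_pmod (v %/ b) (_ : 0 < b ^ size w)%N;
    have := ltn_pmod v b0; rewrite expn_gt0 b0 expnSr => + /(_ isT); nia.
have := digit_lt x (i + size w) b0; move: (digit _ _ _) => d' d'b.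
apply/andP/eqP => [[/eqP -> /eqP ->]//|E].
have : (word_value b w * b + d)%N = (digit_block b x i (size w) * b + d')%N by [].
move=> /[dup] /(congr1 (divn^~ b)) + /(congr1 (modn^~ b)).
by rewrite !divnMDl// !modnMDl !divn_small// !modn_small// !addn0 => -> ->.
Qed.

Lemma word_countE (R : realType) (b : nat) (x : R) (w : seq 'I_b) (n : nat) :
  (0 < b)%N ->
  word_count x w n = block_count b x (size w) (word_value b (map val w)) n.
Proof.
move=> b0; rewrite /word_count /block_count -(big_mkord xpredT
  (fun i => (digit_block b x i (size w) == word_value b (map val w)) : nat)).
rewrite /index_iota subn0 -sum1_count big_mkcond /=; apply: eq_bigr => i _.
rewrite -[size w](size_map val) digit_block_word//.
by apply/allP => _ /mapP[d _ ->]; apply: ltn_ord.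
Qed.

Lemma word_value_surj (b k c : nat) : (0 < b)%N -> (c < b ^ k)%N ->
  exists w : seq 'I_b, size w = k /\ word_value b (map val w) = c.
Proof.
move=> b0; elim: k c => [|k IH] c cb.
  by exists [::]; move: cb; rewrite expn0; case: c.
have cb' : (c %/ b < b ^ k)%N by rewrite ltn_divLR// -expnSr.
have [w [sw vw]] := IH _ cb'.
exists (rcons w (Ordinal (ltn_pmod c b0))); split; first by rewrite size_rcons sw.
by rewrite map_rcons /word_value foldl_rcons -/(word_value _ _) vw /= -divn_eq.
Qed.

(** * The hot spot criterion *)

Lemma normal_block_count_le (R : realType) (b : nat) (x : R) (k c : nat) :
  (0 < b)%N -> normal_numbers R b x -> (c < b ^ k)%N ->
  exists n0, forall n, (n0 <= n)%N -> (block_count b x k c n * b ^ k <= 2 * n)%N.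
Proof.
move=> b0 nx cb; have [w [sw vw]] := word_value_surj b0 cb.
have bk0 : 0 < b%:R ^+ k :> R by rewrite exprn_gt0 ?ltr0n.
have := nx w; rewrite sw => /cvgrPdist_le /(_ (b%:R ^- k)).
rewrite invr_gt0 bk0 => /(_ isT)[n0 _ H]; exists n0.+1 => n n0n.
have n_gt0 : 0 < n%:R :> R by rewrite ltr0n; lia.
have := H n (ltnW n0n); rewrite /= word_countE// sw vw.
rewrite distrC ler_norml => /andP[_]; rewrite lerBlDr ler_pdivrMr//.
have -> : (b%:R ^- k + b%:R ^- k) * n%:R = 2 * n%:R / b%:R ^+ k :> R by ring.
rewrite ler_pdivlMr//.
by rewrite -natrX -!natrM ler_nat.
Qed.

Lemma normal_of_block_count (R : realType) (b : nat) (x : R) :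
  (0 < b)%N ->
  (forall k c (e : R), (c < b ^ k)%N -> 0 < e -> exists n0, forall n, (n0 <= n)%N ->
    `|(block_count b x k c n)%:R - n%:R * b%:R ^- k| <= e * n%:R) ->
  normal_numbers R b x.
Proof.
move=> b0 H w; apply/cvgrPdist_le => e e0.
have wb : all (fun d => d < b)%N (map val w).
  by apply/allP => _ /mapP[d _ ->]; apply: ltn_ord.
have := word_value_lt wb; rewrite size_map => /H/(_ e0)[n0 Hn].
exists n0.+1 => //= n n0n; rewrite distrC word_countE//.
have n_gt0 : 0 < n%:R :> R by rewrite ltr0n (leq_trans _ n0n).
rewrite -(ler_pM2r n_gt0) -{2}(gtr0_norm n_gt0) -normrM mulrBl divfK ?gt_eqF//.
by rewrite [_ * n%:R]mulrC; apply: Hn; apply: ltnW.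
Qed.

(** Shifting the window of summation by [j] changes only [j] terms at either end. *)
Lemma sum_shift_dist (R : realType) (f : nat -> bool) (n j : nat) :
  `|\sum_(i < n) (f (i + j)%N)%:R - (\sum_(i < n) f i)%:R| <= j%:R :> R.
Proof.
have E : \sum_(i < n) (f (i + j)%N)%:R + \sum_(i < j) (f i)%:R =
    \sum_(i < n) (f i)%:R + \sum_(i < j) (f (i + n)%N)%:R :> R.
  transitivity (\sum_(i < n + j) (f i)%:R : R).
    rewrite addnC big_split_ord /= addrC; congr (_ + _).
    by apply: eq_bigr => i _; rewrite addnC.
  rewrite big_split_ord /=; congr (_ + _).
  by apply: eq_bigr => i _; rewrite addnC.
have bnd (g : nat -> bool) : 0 <= (\sum_(i < j) (g i)%:R : R) <= j%:R.
  apply/andP; split; first by apply: sumr_ge0.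
  rewrite -[X in _ <= X%:R](card_ord j) -sum1_card natr_sum /=.
  by apply: ler_sum => i _; case: (g i).
rewrite natr_sum ler_norml; move: (bnd f) (bnd (fun i => f (i + n)%N)) E.
by move=> /andP[? ?] /andP[? ?] ?; lra.
Qed.

Lemma sum_digit_block (R : realType) (b : nat) (x : R) (M n : nat) (G : nat -> R) :
  (0 < b)%N ->
  \sum_(i < n) G (digit_block b x i M) =
  \sum_(v < b ^ M) G v * (block_count b x M v n)%:R.
Proof.
move=> b0; under [RHS]eq_bigr do rewrite /block_count natr_sum mulr_sumr.
rewrite exchange_big; apply: eq_bigr => i _ /=.
have lt : (digit_block b x i M < b ^ M)%N by rewrite ltn_pmod// expn_gt0 b0.
rewrite (bigD1 (Ordinal lt))//= eqxx mulr1 big1 ?addr0// => v.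
by rewrite -val_eqE eq_sym /= => /negPf ->; rewrite mulr0.
Qed.

(** Double counting: each occurrence of the block is seen through each of the [L]
positions of a sliding window, up to boundary terms. *)
Lemma count_dev_window (R : realType) (b : nat) (x : R) (k c L n : nat) :
  (0 < b)%N ->
  `|\sum_(i < n) count_dev R b k c L (digit_block b x i (L + k)) -
    L%:R * ((block_count b x k c n)%:R - n%:R * b%:R ^- k)| <= L%:R * L%:R.
Proof.
move=> b0; rewrite /count_dev exchange_big /=.
rewrite [X in X * (_ - _)](_ : L%:R = \sum_(s < L) 1); last first.
  by rewrite sumr_const card_ord.
rewrite mulr_suml -sumrB; apply: le_trans (ler_norm_sum _ _ _) _.
rewrite -[X in _ <= _ * X%:R]card_ord mulr_natr -sumr_const.
apply: ler_sum => s _; rewrite mul1r /block_dev sumrB sumr_const card_ord.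
rewrite mulr_natl opprB addrA subrK.
have -> : \sum_(i < n) (block b (digit_block b x i (L + k)) s k == c)%:R =
    \sum_(i < n) (digit_block b x (i + (L - s)) k == c)%:R :> R.
  apply: eq_bigr => i _; rewrite -(block_digit_block x i (L - s) s k b0).
  by rewrite addnAC subnK// ltnW.
apply: le_trans (sum_shift_dist R (fun i => digit_block b x i k == c) _ _) _.
by rewrite ler_nat leq_subr.
Qed.

Lemma le_add_sqr_div (R : realFieldType) (t y : R) : 0 < t -> `|y| <= t + y ^+ 2 / t.
Proof.
move=> t0; rewrite -(ler_pM2r t0) mulrDl divfK ?gt_eqF// -real_normK ?num_real//.
by nra.
Qed.

(** By [count_dev_window] the deviation of the frequency of a block is, up to
[O(1 / n)], the mean over the windows of length [L + k] of the deviation inside a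
window, divided by [L].  The hypothesis bounds this mean by [C] times the one for
uniformly distributed windows, which is small for large [L] by the second-moment
estimate. *)
Theorem hot_spot (R : realType) (b : nat) (x : R) (C : nat) :
  (0 < b)%N ->
  (forall k c, (c < b ^ k)%N -> exists n0, forall n, (n0 <= n)%N ->
     (block_count b x k c n * b ^ k <= C * n)%N) ->
  normal_numbers R b x.
Proof.
move=> b0 H; apply: normal_of_block_count => // k c e cb e0.
pose C1 : R := C%:R + 1.
have C1_gt0 : 0 < C1 by rewrite ltr_wpDl.
(* The three terms to absorb: the edge effects [L / n], made at most [d], and the
   two terms of [le_add_sqr_div] at [t = d * L], each at most [C * d]. *)
pose d := e / (3 * C1); have d0 : 0 < d by rewrite divr_gt0// mulr_gt0.
pose L := (Num.truncn ((2 * k)%:R / d ^+ 2)).+1.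
have Ld : (2 * k)%:R <= d ^+ 2 * L%:R.
  by rewrite mulrC -ler_pdivrMr ?exprn_gt0// ltW// truncnS_gt.
have L0 : 0 < L%:R :> R by rewrite ltr0n.
pose M := (L + k)%N.
have bM0 : 0 < (b ^ M)%:R :> R by rewrite ltr0n expn_gt0 b0.
have [n0 Hn0] : exists n0, forall n, (n0 <= n)%N -> forall v : 'I_(b ^ M),
    (block_count b x M v n * b ^ M <= C * n)%N.
  have /choice[g Hg] : forall v : 'I_(b ^ M), exists n0, forall n, (n0 <= n)%N ->
    (block_count b x M v n * b ^ M <= C * n)%N by move=> v; apply: H.
  exists (\max_v g v)%N => n gn v; apply: Hg.
  by apply: leq_trans gn; apply: leq_bigmax.
pose n1 := (Num.truncn (L%:R / d)).+1.
exists (maxn n0 n1) => n; rewrite geq_max => /andP[/Hn0 {}Hn0 n1n].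
have Ln : L%:R <= d * n%:R.
  rewrite mulrC -ler_pdivrMr// (le_trans (ltW (truncnS_gt _)))// ler_nat//.
(* [SD] bounds the edge effects; [Sle] bounds the windows by the second moment. *)
have := @count_dev_window R b x k c L n b0; rewrite -/M.
set D := _ - n%:R * _; set S := \sum_(i < n) _ => SD.
have Sle : `|S| <= L%:R * (2 * C%:R * d * n%:R).
  rewrite /S sum_digit_block//; apply: le_trans (ler_norm_sum _ _ _) _.
  have t0 : 0 < d * L%:R by rewrite mulr_gt0.
  apply: (@le_trans _ _ (\sum_(v < b ^ M)
     (d * L%:R + count_dev R b k c L v ^+ 2 / (d * L%:R)) * (C%:R * n%:R / (b ^ M)%:R))).
    apply: ler_sum => v _; rewrite normrM ler_pM//; first exact: le_add_sqr_div.
    by rewrite ger0_norm// ler_pdivlMr// -!natrM ler_nat.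
  rewrite -mulr_suml big_split /= sumr_const card_ord -mulr_suml.
  rewrite [leLHS]mulrA ler_pdivrMr// -[_ *+ _]mulr_natr.
  have := @sum_count_dev_sqr R b k c L b0 cb; rewrite -/M.
  set Q := \sum_(i < _) _ => Qle.
  have : Q / (d * L%:R) <= d * L%:R * (b ^ M)%:R.
    rewrite ler_pdivrMr//; apply: le_trans Qle _; rewrite !natrM.
    have -> : d * L%:R * (b ^ M)%:R * (d * L%:R) =
       (d ^+ 2 * L%:R) * L%:R * (b ^ M)%:R by ring.
    by rewrite ler_pM2r// ler_pM2r// -natrM.
  move: (Q / _) => q qle.
  have Cn : 0 <= C%:R * n%:R :> R by rewrite mulr_ge0.
  have -> : L%:R * (2 * C%:R * d * n%:R) * (b ^ M)%:R =
    (d * L%:R * (b ^ M)%:R + d * L%:R * (b ^ M)%:R) * (C%:R * n%:R) by ring.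
  by apply: ler_wpM2r => //; rewrite lerD2l.
have LD : L%:R * `|D| <= L%:R * (3 * C1 * d * n%:R).
  rewrite -[X in X * `|D|](gtr0_norm L0) -normrM.
  have -> : L%:R * D = S - (S - L%:R * D) by ring.
  apply: le_trans (ler_normB _ _) _; apply: le_trans (lerD Sle SD) _.
  rewrite -mulrDr ler_pM2l// (le_trans (lerD (lexx _) Ln))//.
  rewrite /C1.
  have : 0 <= d * n%:R by rewrite mulr_ge0// ltW.
  have : 0 <= C%:R * (d * n%:R) by rewrite mulr_ge0// mulr_ge0// ltW.
  by nra.
move: LD; rewrite ler_pM2l// (_ : 3 * C1 * d = e)//.
by rewrite mulrC /d divfK// mulf_neq0// gt_eqF.
Qed.

(** * Rational affine maps preserve normality *)

Lemma digit_block_itv (R : realType) (b : nat) (x : R) (i k : nat) : (0 < b)%N ->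
  exists z : int,
    ((b ^ k)%N%:Z * z + (digit_block b x i k)%:Z)%:~R <= b%:R ^+ (i + k) * x
      < ((b ^ k)%N%:Z * z + (digit_block b x i k)%:Z + 1)%:~R.
Proof.
move=> b0; rewrite /digit_block.
exists ((digit_prefix b x (i + k) %/ b ^ k)%N%:Z + (b ^ i)%N%:Z * Num.floor x).
have y0 : 0 <= b%:R ^+ (i + k) * frac_part x :> R.
  by rewrite mulr_ge0 ?exprn_ge0 ?frac_part_ge0.
have := truncn_itv y0; rewrite -/(digit_prefix b x (i + k)).
set P := digit_prefix _ _ _.
have -> : b%:R ^+ (i + k) * x =
    b%:R ^+ (i + k) * frac_part x + ((b ^ k)%N%:Z * ((b ^ i)%N%:Z * Num.floor x))%:~R.
  rewrite /frac_part mulrBr !intrM -!pmulrn !natrX exprD mulrA.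
  by rewrite [b%:R ^+ k * _]mulrC subrK.
have -> : (b ^ k)%N%:Z * ((P %/ b ^ k)%N%:Z + (b ^ i)%N%:Z * Num.floor x) + (P %% b ^ k)%N%:Z
  = P%:Z + (b ^ k)%N%:Z * ((b ^ i)%N%:Z * Num.floor x).
  by rewrite {3}(divn_eq P (b ^ k)) PoszD PoszM; ring.
rewrite [X in _ < X%:~R]addrAC => /andP[h1 h2].
by rewrite 3!intrD -!pmulrn lerD2r h1 ltrD2r natr1.
Qed.

(** The integer [G] collects the unknown multiples of [B].  The two inequalities
leave it boundedly many values, and then leave [q * v] boundedly many values: so
[v] is one of [(p + q) * (p + q)] integers that depend on [c] alone. *)
Lemma affine_block_arith (B p q c v : nat) (G : int) :
  (0 < B)%N -> (c < B)%N -> (v < B)%N -> (0 < q)%N ->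
  (q * v)%N%:Z + B%:Z * G < (p * c + p)%N%:Z ->
  (p * c)%N%:Z < (q * v + q)%N%:Z + B%:Z * G ->
  exists g t, [/\ (g < p + q)%N, (t < p + q)%N &
    v = ((p * c + t + q * B - B * g - q) %/ q)%N].
Proof.
move=> B0 cB vB q0 h1 h2.
have Gp : G < p%:Z by nia.
have Gq : - q%:Z < G by nia.
(* The bounds [- q < G < p] and [0 < q * v + q + B * G - p * c < p + q] turn both
   quantities into naturals below [p + q]. *)
exists `|(G + q%:Z)%R|%N, `|((q * v + q)%N%:Z + B%:Z * G - (p * c)%N%:Z)%R|%N; split.
- by lia.
- by lia.
have E : (p * c + `|((q * v + q)%N%:Z + B%:Z * G - (p * c)%N%:Z)%R| + q * B)%N =
    (q * v + q + B * `|(G + q%:Z)%R|)%N.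
  apply/eqP; rewrite -eqz_nat; apply/eqP; rewrite !PoszD !PoszM !gez0_abs; first ring.
    by lia.
  by lia.
by rewrite E addnK addnK mulKn.
Qed.

(** Wall's theorem, in the form needed here: at every place where the block [c]
occurs in [y], one of the [(p + q) ^ 2] blocks provided by [affine_block_arith]
occurs in [x], and these have frequency [b ^- k] there. *)
Lemma normal_affine_int (R : realType) (b : nat) (x y : R) (p q : nat) (r : int) :
  (0 < b)%N -> (0 < p)%N -> (0 < q)%N ->
  q%:R * x = p%:R * y + r%:~R ->
  normal_numbers R b x -> normal_numbers R b y.
Proof.
move=> b0 p0 q0 xy nx; apply: (@hot_spot R b y ((p + q) * (p + q) * 2)) => // k c cb.
have bk0 : (0 < b ^ k)%N by rewrite expn_gt0 b0.
pose Phi (g t : nat) := ((p * c + t + q * b ^ k - b ^ k * g - q) %/ q)%N.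
have blk i : digit_block b y i k = c -> exists g t : 'I_(p + q),
    digit_block b x i k = Phi g t.
  have vb : (digit_block b x i k < b ^ k)%N by rewrite ltn_pmod.
  have [z' /andP[z1' z2']] := digit_block_itv x i k b0.
  have [z /andP[z1 z2]] := digit_block_itv y i k b0 => yc.
  rewrite yc in z1 z2; set v := digit_block b x i k in z1' z2' vb *.
  have q0' : 0 < q%:R :> R by rewrite ltr0n.
  have p0' : 0 < p%:R :> R by rewrite ltr0n.
  have E : q%:R * (b%:R ^+ (i + k) * x) =
      p%:R * (b%:R ^+ (i + k) * y) + (b ^ k)%N%:R * ((b ^ i)%N%:R * r%:~R) :> R.
    by rewrite mulrCA xy !natrX exprD; ring.
  have h1 : (q%:Z * ((b ^ k)%N%:Z * z' + v%:Z))%:~R <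
      (p%:Z * ((b ^ k)%N%:Z * z + c%:Z + 1) + (b ^ k)%N%:Z * ((b ^ i)%N%:Z * r))%:~R :> R.
    rewrite intrM -pmulrn (le_lt_trans (y := q%:R * (b%:R ^+ (i + k) * x)))//.
      by rewrite ler_pM2l.
    by rewrite E intrD intrM -pmulrn 2!(intrM _ (_%:Z)) -!pmulrn ltrD2r ltr_pM2l.
  have h2 : (p%:Z * ((b ^ k)%N%:Z * z + c%:Z) + (b ^ k)%N%:Z * ((b ^ i)%N%:Z * r))%:~R <
      (q%:Z * ((b ^ k)%N%:Z * z' + v%:Z + 1))%:~R :> R.
    rewrite [ltRHS]intrM -pmulrn (le_lt_trans (y := q%:R * (b%:R ^+ (i + k) * x)))//.
      by rewrite E intrD intrM -pmulrn 2!(intrM _ (_%:Z)) -!pmulrn lerD2r ler_pM2l.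
    by rewrite ltr_pM2l.
  rewrite ltr_int in h1; rewrite ltr_int in h2.
  have [||g [t [gpq tpq vE]]] := @affine_block_arith (b ^ k) p q c v
    (q%:Z * z' - p%:Z * z - (b ^ i)%N%:Z * r) bk0 cb vb q0.
  - by move: h1; rewrite !PoszD !PoszM; lia.
  - by move: h2; rewrite !PoszD !PoszM; lia.
  by exists (Ordinal gpq), (Ordinal tpq).
have [n0 Hn0] : exists n0, forall n, (n0 <= n)%N -> forall gt : 'I_(p + q) * 'I_(p + q),
    (block_count b x k (Phi gt.1 gt.2) n * b ^ k <= 2 * n)%N.
  have /choice[f Hf] : forall gt : 'I_(p + q) * 'I_(p + q), exists n0,
      forall n, (n0 <= n)%N -> (block_count b x k (Phi gt.1 gt.2) n * b ^ k <= 2 * n)%N.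
    move=> gt; case: (ltnP (Phi gt.1 gt.2) (b ^ k)%N) => h.
      exact: normal_block_count_le.
    exists 0%N => n _; rewrite /block_count big1// => i _.
    by rewrite (_ : _ == _ = false)//; apply/negbTE; rewrite neq_ltn (leq_trans _ h)// ltn_pmod.
  exists (\max_v f v)%N => n gn v; apply: Hf.
  by apply: leq_trans gn; apply: leq_bigmax.
exists n0 => n /Hn0 {}Hn0.
apply: (@leq_trans (\sum_(gt : 'I_(p + q) * 'I_(p + q))
   block_count b x k (Phi gt.1 gt.2) n * b ^ k)%N); last first.
  apply: (@leq_trans (\sum_(gt : 'I_(p + q) * 'I_(p + q)) 2 * n)%N).
    by apply: leq_sum.
  by rewrite sum_nat_const card_prod card_ord mulnA.
rewrite -big_distrl leq_mul2r; apply/orP; right.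
rewrite /block_count exchange_big; apply: leq_sum => i _.
case: eqP => // /blk[g [t E]].
by rewrite (bigD1 (g, t))//= E eqxx.
Qed.

Lemma normal_affine (R : realType) (b : nat) (x y : R) (a c : rat) :
  (0 < b)%N -> 0 < a -> x = ratr a * y + ratr c ->
  normal_numbers R b x -> normal_numbers R b y.
Proof.
move=> b0 a0 xy; apply: (@normal_affine_int R b x y
  (`|numq a| * `|denq c|) (`|denq a| * `|denq c|) (numq c * denq a)) => //.
- by rewrite muln_gt0 !absz_gt0 denq_neq0 numq_eq0 gt_eqF.
- by rewrite muln_gt0 !absz_gt0 !denq_neq0.
have da : (denq a)%:~R != 0 :> R by rewrite intr_eq0 denq_neq0.
have dc : (denq c)%:~R != 0 :> R by rewrite intr_eq0 denq_neq0.
rewrite !natrM xy /ratr !natr_absz !ger0_norm ?denq_ge0 ?numq_ge0 ?ltW// intrM.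
by field; rewrite da dc.
Qed.

(** * Almost every number is normal *)

(** The numbers of [[0, 1[] for which the number of occurrences of [c] among the first
[L + k] digits is off by more than its expected value, as a union of [b]-adic
intervals. *)
Definition bad_block_set (R : realType) (b k c L : nat) : set R :=
  \big[setU/set0]_(v < b ^ (L + k))
    if L%:R * b%:R ^- k < `|count_dev R b k c L v|
    then `[v%:R / b%:R ^+ (L + k), v.+1%:R / b%:R ^+ (L + k)[%classic else set0.

Lemma measurable_bad_block_set (R : realType) (b k c L : nat) :
  measurable (@bad_block_set R b k c L).
Proof. by apply: bigsetU_measurable => v _; case: ifP. Qed.

(** Chebyshev's inequality. *)
Lemma measure_bad_block_set (R : realType) (b k c L : nat) :
  (0 < b)%N -> (c < b ^ k)%N -> (0 < L)%N ->
  (lebesgue_measure (@bad_block_set R b k c L) <=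
    ((2 * k * b ^ (2 * k))%:R / L%:R)%:E)%E.
Proof.
move=> b0 cb L0; set M := (L + k)%N.
have L0' : 0 < L%:R :> R by rewrite ltr0n.
have bM0 : 0 < b%:R ^+ M :> R by rewrite exprn_gt0 ?ltr0n.
have bk0 : 0 < b%:R ^+ k :> R by rewrite exprn_gt0 ?ltr0n.
pose A (v : nat) : set R := if L%:R * b%:R ^- k < `|count_dev R b k c L v|
    then `[v%:R / b%:R ^+ M, v.+1%:R / b%:R ^+ M[%classic else set0.
apply: (@le_trans _ _ (\sum_(v < b ^ M) lebesgue_measure (A v))%E).
  by apply: Boole_inequality => v _; rewrite /A; case: ifP.
apply: (@le_trans _ _ (\sum_(v < b ^ M)
   (count_dev R b k c L v ^+ 2 / ((L%:R * b%:R ^- k) ^+ 2 * b%:R ^+ M))%:E)%E).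
  apply: lee_sum => v _; rewrite /A; case: ifPn => [h|_]; last first.
    by rewrite measure0 lee_fin divr_ge0// ?sqr_ge0// mulr_ge0 ?sqr_ge0// ltW.
  rewrite lebesgue_measure_itv /= lte_fin ltr_pM2r ?invr_gt0// ltr_nat ltnSn.
  rewrite -EFinB lee_fin -mulrBl -natr1 addrAC subrr add0r mul1r.
  rewrite invfM mulrA ler_peMl ?invr_ge0// ?(ltW bM0)//.
  have Lp : 0 < L%:R * b%:R ^- k :> R by rewrite mulr_gt0// invr_gt0.
  rewrite ler_pdivlMr ?exprn_gt0// mul1r -[leRHS]real_normK ?num_real//.
  by rewrite ler_sqr ?nnegrE ?(ltW Lp)// ltW.
rewrite sumEFin lee_fin -mulr_suml.
have := @sum_count_dev_sqr R b k c L b0 cb; rewrite -/M; set Q := \sum_(_ < _) _ => Qle.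
rewrite ler_pdivrMr ?mulr_gt0// ?exprn_gt0 ?mulr_gt0 ?invr_gt0//.
apply: le_trans Qle _; rewrite le_eqVlt; apply/orP; left; apply/eqP.
rewrite !natrM !natrX mulnC exprM.
by field; rewrite !gt_eqF.
Qed.

Lemma bad_block_setP (R : realType) (b k c L : nat) (x : R) :
  (0 < b)%N -> 0 <= x < 1 -> ~ bad_block_set b k c L x ->
  (block_count b x k c L * b ^ k <= 2 * L + b ^ k)%N.
Proof.
move=> b0 x01 nbad; set M := (L + k)%N.
have bM0 : 0 < b%:R ^+ M :> R by rewrite exprn_gt0 ?ltr0n.
have bk0 : 0 < b%:R ^+ k :> R by rewrite exprn_gt0 ?ltr0n.
have fx : frac_part x = x.
  rewrite /frac_part (_ : Num.floor x = 0) ?subr0//.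
  by apply: floor_def; rewrite add0r.
pose v := digit_prefix b x M.
have vlt : (v < b ^ M)%N by apply: digit_prefix_lt.
have dv : `|count_dev R b k c L v| <= L%:R * b%:R ^- k.
  rewrite leNgt; apply/negP => h; apply: nbad.
  rewrite /bad_block_set -/M (bigD1 (Ordinal vlt))//= h; left => /=.
  have y0 : 0 <= b%:R ^+ M * frac_part x :> R.
    by rewrite mulr_ge0 ?exprn_ge0 ?frac_part_ge0.
  have := truncn_itv y0; rewrite -/(digit_prefix b x M) -/v fx in_itv /=.
  by rewrite ler_pdivrMr// ltr_pdivlMr// [x * _]mulrC.
have E : count_dev R b k c L v =
    \sum_(i < L) (digit_block b x (i + 1) k == c)%:R - L%:R * b%:R ^- k.
  rewrite /count_dev /block_dev sumrB sumr_const card_ord mulr_natl; congr (_ - _).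
  rewrite (reindex_inj rev_ord_inj); apply: eq_bigr => i _ /=.
  have -> : v = digit_block b x 0 (i + 1 + k + (L - i.+1)).
    rewrite /digit_block add0n (_ : (i + 1 + k + (L - i.+1))%N = M); last first.
      by rewrite /M; have := ltn_ord i; lia.
    by rewrite modn_small.
  by rewrite block_digit_block// add0n.
have := @sum_shift_dist R (fun i => digit_block b x i k == c) L 1.
rewrite -/(block_count b x k c L) => sd.
rewrite -(ler_nat R) natrM natrD natrM natrX -ler_pdivlMr//.
have -> : (2 * L%:R + b%:R ^+ k) / b%:R ^+ k = L%:R * b%:R ^- k + L%:R * b%:R ^- k + 1 :> R.
  by field; rewrite gt_eqF.
move: dv sd; rewrite E; move: (\sum_(i < L) _) => S.
move: (L%:R / _) (block_count _ _ _ _ _)%:R => p N.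
by rewrite !ler_norml => /andP[? ?] /andP[? ?]; lra.
Qed.

(** Occurrence counts are monotone in [n], so bounds at the powers of two yield
bounds at all [n] up to a factor two; [hot_spot] is insensitive to that factor. *)
Lemma not_normal_sub_lim_sup (R : realType) (b : nat) (x : R) :
  (0 < b)%N -> 0 <= x < 1 -> ~ normal_numbers R b x ->
  exists k c, (c < b ^ k)%N /\ lim_sup_set (fun j => bad_block_set b k c (2 ^ j)) x.
Proof.
move=> b0 x01; apply: contra_notP => H; apply: (@hot_spot R b x 6) => // k c cb.
have [j0 Hj0] : exists j0, forall j, (j0 <= j)%N -> ~ bad_block_set b k c (2 ^ j) x.
  apply: contrapT => Hn; apply: H; exists k, c; split => // j0 _.
  apply: contrapT => Hj; apply: Hn; exists j0 => j j0j bx; apply: Hj.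
  by exists j.
(* From [2 ^ (b ^ k)] on, the boundary term [b ^ k] of [bad_block_setP] is absorbed. *)
exists (2 ^ (maxn j0 (b ^ k)))%N => n n0.
have n_gt0 : (0 < n)%N by apply: leq_trans n0; rewrite expn_gt0.
have /andP[n1 n2] := trunc_log_bounds (isT : 1 < 2)%N n_gt0.
set j := trunc_log 2 n in n1 n2.
have jm : (maxn j0 (b ^ k) <= j.+1)%N.
  by rewrite -(@leq_exp2l 2)// ltnW// (leq_ltn_trans n0).
move: jm; rewrite geq_max => /andP[/Hj0 j1 j2].
have bj : (b ^ k <= 2 ^ j.+1)%N by apply: leq_trans j2 (ltnW (ltn_expl _ _)).
have := bad_block_setP b0 x01 j1.
have : (block_count b x k c n <= block_count b x k c (2 ^ j.+1))%N.
  rewrite /block_count -(subnKC (ltnW n2)) big_split_ord /=; exact: leq_addr.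
move=> /(leq_mul) /(_ (leqnn (b ^ k))) h1 h2.
apply: leq_trans h1 (leq_trans h2 _).
by move: bj n1; rewrite expnS; lia.
Qed.

(** Along the powers of two the Chebyshev bounds form a geometric series, and
Borel-Cantelli applies. *)
Lemma lim_sup_bad_block_set (R : realType) (b k c : nat) :
  (0 < b)%N -> (c < b ^ k)%N ->
  (@lebesgue_measure R).-negligible
    (lim_sup_set (fun j => @bad_block_set R b k c (2 ^ j))).
Proof.
move=> b0 cb.
have mB j := @measurable_bad_block_set R b k c (2 ^ j).
apply/negligibleP.
  apply: bigcapT_measurable => n; apply: bigcup_measurable => j _; exact: mB.
apply: lim_sup_set_cvg0 => //.
set K : R := (2 * k * b ^ (2 * k))%:R.
apply: (@le_lt_trans _ _ (\sum_(j <oo) (K / (2 ^ j)%:R)%:E)%E).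
  apply: lee_nneseries => // j _; apply: measure_bad_block_set => //.
  by rewrite expn_gt0.
have E : (\sum_(j <oo) (K / (2 ^ j)%:R)%:E)%E = (2 * K)%:E.
  have := @cvg_geometric_eseries_half R (2 * K) 0; rewrite expr0 divr1 => /cvg_lim <- //.
  congr (limn _); apply/funext => n; apply: eq_bigr => j _; congr (_%:E).
  rewrite addn1 expnS natrM; field.
  by rewrite natrX expf_neq0// pnatr_eq0.
by rewrite E ltry.
Qed.

Theorem negligible_not_normal (R : realType) (b : nat) : (0 < b)%N ->
  (@lebesgue_measure R).-negligible [set x | 0 <= x < 1 /\ ~ normal_numbers R b x].
Proof.
move=> b0.
pose G k c : set R := if (c < b ^ k)%N
  then lim_sup_set (fun j => bad_block_set b k c (2 ^ j)) else set0.
have : (@lebesgue_measure R).-negligible (\bigcup_k \bigcup_c G k c).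
  apply: negligible_bigcup => k; apply: negligible_bigcup => c; rewrite /G.
  by case: ifP => cb; [exact: lim_sup_bad_block_set|exact: negligible_set0].
apply: negligibleS.
move=> x /= [x01 /(not_normal_sub_lim_sup b0 x01)[k [c [cb xL]]]].
by exists k => //; exists c => //; rewrite /G cb.
Qed.

(** * A staircase that is locally constant near a null set *)

(** With [U] an open cover of the null set of measure less than 1/2, take for [m y]
the measure of the part of [[0, 1] `\` U] below [y]. *)
Lemma exists_staircase (R : realType) (N : set R) :
  (@lebesgue_measure R).-negligible N ->
  exists m : R -> R,
    [/\ forall y z, y <= z -> 0 <= m z - m y <= z - y,
        forall y, y <= 0 -> m y = m 0,
        forall y, 1 <= y -> m y = m 1,
        m 0 < m 1
      & forall y, N y -> \forall z \near y, m z = m y].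
Proof.
move=> [A [mA A0 NA]]; pose mu : measure _ _ := @lebesgue_measure R.
have muI (i : interval R) : mu [set` i] =
    (if i.1 < i.2 then (i.2 : \bar R) - i.1 else 0)%E := lebesgue_measure_itv i.
have [U [oU AU UA]] : exists U : set R,
    [/\ open U, A `<=` U & (mu (U `\` A) < (2^-1)%:E)%E].
  by apply: lebesgue_regularity_outer => //; rewrite [X in (X < _)%E](_ : _ = 0%E) ?ltry.
have mU : measurable U by exact: measurable_realfun.open_measurable.
have U2 : (mu U < (2^-1)%:E)%E.
  rewrite -(setDUK AU) measureU//; last 2 first.
  - exact: measurableD.
  - by rewrite setDIK.
  by rewrite [X in (X + _)%E](_ : _ = 0%E) ?add0e.
pose K : set R := `[0, 1] `\` U.
have mK : measurable K by apply: measurableD.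
have K1 (B : set R) : measurable B -> (mu (K `&` B) <= 1)%E.
  move=> mB; apply: (@le_trans _ _ (mu `[0, 1]%classic)).
    apply: le_measure; rewrite ?inE//; first exact: measurableI.
    by move=> x [[]].
  by rewrite muI/= lte_fin ltr01 oppr0 adde0.
have Kfin (B : set R) : measurable B -> mu (K `&` B) \is a fin_num.
  by move=> mB; rewrite ge0_fin_numE// (le_lt_trans (K1 _ mB))// ltry.
pose m (y : R) : R := fine (mu (K `&` `]-oo, y])).
have mB (y z : R) : y <= z -> m z - m y = fine (mu (K `&` `]y, z])).
  move=> yz; rewrite /m.
  have -> : K `&` `]-oo, z] = (K `&` `]-oo, y]) `|` (K `&` `]y, z]).
    rewrite -setIUr; congr (_ `&` _); apply/seteqP; split => x /=; rewrite !in_itv/=.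
      by move=> xz; case: (leP x y) => xy; [left|right; rewrite ?xy].
    by case=> [xy|/andP[]//]; apply: le_trans yz.
  rewrite measureU//; [|exact: measurableI|exact: measurableI|]; last first.
    rewrite setIACA setIid (_ : `]-oo, y] `&` `]y, z] = set0) ?setI0//.
    by apply/seteqP; split => x //= []; rewrite !in_itv/= => xy /andP[]; rewrite ltNge xy.
  by rewrite fineD ?Kfin// addrAC subrr add0r.
exists m; split.
- move=> y z yz; rewrite mB//; apply/andP; split; first exact: fine_ge0.
  rewrite -lee_fin fineK ?Kfin//.
  apply: (@le_trans _ _ (mu `]y, z]%classic)).
    by apply: le_measure; rewrite ?inE//; exact: measurableI.
  by rewrite muI/= lte_fin; case: ltP => // _; rewrite lee_fin subr_ge0.
- have m0 y : y <= 0 -> m y = 0.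
    move=> y0; rewrite /m (_ : mu _ = 0%E)//; apply/eqP; rewrite -measure_le0.
    have <- : mu `[0, 0]%classic = 0%E.
      by rewrite muI/= lte_fin ltxx.
    apply: le_measure; rewrite ?inE//; first exact: measurableI.
    move=> x [[]] /=; rewrite !in_itv/= => /andP[x0 _] _ xy.
    by rewrite x0 (le_trans xy).
  by move=> y y0; rewrite !m0.
- move=> y y1; congr (fine (mu _)); apply/seteqP.
  by split=> x [Kx]; split => //; case: Kx; rewrite /= !in_itv/= => /andP[_ x1] _ //;
    apply: le_trans y1.
- rewrite -subr_gt0 mB//.
  suff: (0 < mu (K `&` `]0%R, 1%R]))%E by move=> h; apply: fine_gt0; rewrite h (le_lt_trans (K1 _ _))// ltry.
  have : (mu `]0%R, 1%R] <= mu (K `&` `]0%R, 1%R]) + mu U)%E.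
    apply: (@le_trans _ _ (mu ((K `&` `]0%R, 1%R]) `|` U))).
      apply: le_measure; rewrite ?inE//.
        by apply: measurableU => //; apply: measurableI.
      move=> x x01; have [Ux|nUx] := pselect (U x); [by right|left; split => //].
      split => //; move: x01; rewrite /= !in_itv/= => /andP[x0 ->].
      by rewrite ltW.
    by apply: measureU2 => //; apply: measurableI.
  rewrite muI/= lte_fin ltr01 oppr0 adde0 => h.
  rewrite lt0e measure_ge0 andbT; apply/eqP => K0; move: h; rewrite K0 add0e leNgt.
  by rewrite (lt_trans U2)// lte_fin; lra.
move=> y /NA /AU Uy.
have /nbhs_ballP[e /= e0 He] : nbhs y U by apply: open_nbhs_nbhs.
apply/nbhs_ballP; exists e => //= z yez.
have loc (u v : R) : u <= v -> (forall x, u < x <= v -> U x) -> m v = m u.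
  move=> uv HU; apply/eqP; rewrite -subr_eq0 mB//.
  rewrite (_ : K `&` _ = set0) ?measure0//.
  by apply/seteqP; split=> x //= [[_ nU]] xuv; apply: nU; apply: HU; rewrite in_itv in xuv.
move: yez; rewrite /ball/= ltr_norml => /andP[h1 h2].
case: (leP y z) => yz; [|apply/esym]; apply: loc; rewrite ?(ltW yz)// => x /andP[x1 x2].
  by apply: He; rewrite /ball/= ltr_norml; apply/andP; split; lra.
by apply: He; rewrite /ball/= ltr_norml; apply/andP; split; lra.
Qed.

(** * Functions that vary only along a staircase *)

Definition primitive (R : realType) (U u : R -> R) : Prop :=
  forall y, is_derive y (1 : R) U (u y).

Definition staircase (R : realType) (m : R -> R) : Prop :=
  forall y z, y <= z -> 0 <= m z - m y <= z - y.

(** The oscillation of [u] is controlled by that of [m]; in particular [u] is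
constant wherever [m] is.  This confines the variation of [u] to the set carrying [m] without
mentioning that set. *)
Definition lipschitz_along (R : realType) (m : R -> R) (L : R) (u : R -> R) : Prop :=
  forall y z, `|u y - u z| <= L * `|m y - m z|.

(** The combinations formed later are written [u + 1 * v] or [0 + k * v + l * w] so
that this lemma and [lipschitz_alongDZ] apply to them as they stand. *)
Lemma primitiveDZ (R : realType) (k : R) (U u V v : R -> R) :
  primitive U u -> primitive V v ->
  primitive (fun y => U y + k * V y) (fun y => u y + k * v y).
Proof.
move=> PU PV y; have := PU y; have := PV y => DV DU.
exact: (@is_deriveD _ _ _ U (k *: V)).
Qed.

Lemma primitive_continuous (R : realType) (U u : R -> R) :
  primitive U u -> continuous U.
Proof.
move=> PU y; apply/differentiable_continuous/derivable1_diffP.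
by have [] := PU y.
Qed.

Lemma primitive_MVT (R : realType) (U u : R -> R) (a b : R) :
  primitive U u -> a <= b ->
  exists2 c, a <= c <= b & U b - U a = u c * (b - a).
Proof.
move=> PU ab; have [|c] := @MVT_segment R U u a b ab (fun x _ => PU x).
  by apply: continuous_subspaceT; exact: primitive_continuous PU.
by rewrite in_itv; exists c.
Qed.

(** The vanishing of [u] on the left makes a single base point serve for the
fundamental theorem of calculus on the whole line. *)
Lemma exists_primitive (R : realType) (u : R -> R) (a : R) :
  continuous u -> (forall y, y <= a -> u y = 0) ->
  exists2 U, primitive U u & forall y, y <= a -> U y = 0.
Proof.
move=> cu u0.
pose U (x : R) : R := (\int[lebesgue_measure]_(t in [set` `[a - 1, x]]) (u t))%R.
have U0 y : y <= a -> U y = 0.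
  move=> ya; rewrite /U /Rintegral integral0_eq// => t /=; rewrite in_itv/= => /andP[_ ty].
  by rewrite u0// (le_trans ty).
exists U => // y; have [ya|ya] := ltP y a.
  rewrite (u0 _ (ltW ya)).
  have D := is_derive_cst (0 : R) y (1 : R).
  apply: near_eq_is_derive D.
  have : \forall t \near y, t < a by apply: lt_nbhsl.
  by apply: filterS => t ta; rewrite /= U0// ltW.
have : derivable U y 1 /\ U^`() y = u y.
  apply: (@continuous_FTC1_closed R u (a - 1) y (y + 1)).
  - by rewrite ltrDl.
  - apply: continuous_compact_integrable; first exact: segment_compact.
    by apply: continuous_subspaceT.
  - by rewrite ltrBlDr (le_lt_trans ya)// ltrDl.
  - exact: cu.
by rewrite derive1E => -[dU <-]; exact: DeriveDef.
Qed.

Lemma staircase_mono (R : realType) (m : R -> R) (y z : R) :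
  staircase m -> y <= z -> m y <= m z.
Proof. by move=> sm /sm/andP[]; rewrite subr_ge0. Qed.

Lemma staircase_dist (R : realType) (m : R -> R) (y z : R) :
  staircase m -> `|m y - m z| <= `|y - z|.
Proof.
move=> sm; wlog yz : y z / y <= z => [H|].
  by case: (leP y z) => [/H//|/ltW/H]; rewrite distrC [`|z - y|]distrC.
by have /andP[h1 h2] := sm _ _ yz; rewrite distrC ger0_norm// distrC ger0_norm ?subr_ge0.
Qed.

Lemma lipschitz_along_self (R : realType) (m : R -> R) : lipschitz_along m 1 m.
Proof. by move=> y z; rewrite mul1r. Qed.

Lemma lipschitz_along_cst (R : realType) (m : R -> R) (c : R) :
  lipschitz_along m 0 (cst c).
Proof. by move=> y z; rewrite subrr normr0 mul0r. Qed.

Lemma lipschitz_alongDZ (R : realType) (m : R -> R) (k L L' : R) (u v : R -> R) :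
  lipschitz_along m L u -> lipschitz_along m L' v ->
  lipschitz_along m (L + `|k| * L') (fun y => u y + k * v y).
Proof.
move=> hu hv y z.
rewrite (_ : u y + k * v y - _ = (u y - u z) + k * (v y - v z)); last by ring.
apply: le_trans (ler_normD _ _) _; rewrite normrM mulrDl lerD//.
by rewrite -mulrA ler_wpM2l.
Qed.

Lemma lipschitz_alongW (R : realType) (m : R -> R) (L L' : R) (u : R -> R) :
  L <= L' -> lipschitz_along m L u -> lipschitz_along m L' u.
Proof. by move=> LL hu y z; apply: le_trans (hu y z) _; rewrite ler_wpM2r. Qed.

Lemma lipschitz_along_max (R : realType) (m : R -> R) (L : R) (u v : R -> R) :
  lipschitz_along m L u -> lipschitz_along m L v ->
  lipschitz_along m L (fun y => Num.max (u y) (v y)).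
Proof.
move=> hu hv y z; move: (hu y z) (hv y z).
rewrite !ler_norml => /andP[? ?] /andP[? ?].
by case: (leP (u y) (v y)) => ?; case: (leP (u z) (v z)) => ?; apply/andP; split; lra.
Qed.

Lemma lipschitz_along_min (R : realType) (m : R -> R) (L : R) (u v : R -> R) :
  lipschitz_along m L u -> lipschitz_along m L v ->
  lipschitz_along m L (fun y => Num.min (u y) (v y)).
Proof.
move=> hu hv y z; move: (hu y z) (hv y z).
rewrite !ler_norml => /andP[? ?] /andP[? ?].
by case: (leP (u y) (v y)) => ?; case: (leP (u z) (v z)) => ?; apply/andP; split; lra.
Qed.

Lemma lipschitz_along_dist (R : realType) (m : R -> R) (L : R) (u : R -> R) (y z : R) :
  staircase m -> 0 <= L -> lipschitz_along m L u -> `|u y - u z| <= L * `|y - z|.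
Proof.
move=> sm L0 hu; apply: le_trans (hu y z) _.
by rewrite ler_wpM2l// staircase_dist.
Qed.

Lemma dist_le_continuous (R : realType) (L : R) (u : R -> R) :
  0 <= L -> (forall y z, `|u y - u z| <= L * `|y - z|) -> continuous u.
Proof.
move=> L0 hu y; apply/cvgrPdist_lt => e e0.
have d0 : 0 < e / (L + 1) by rewrite divr_gt0// ltr_wpDl.
near=> z; apply: le_lt_trans (hu _ _) _.
have : `|y - z| < e / (L + 1) by near: z; apply/nbhs_ballP; exists (e / (L + 1)).
rewrite ltr_pdivlMr ?ltr_wpDl// => h; apply: le_lt_trans h.
by rewrite mulrC ler_wpM2l// lerDl.
Unshelve. all: by end_near. Qed.

Lemma lipschitz_along_continuous (R : realType) (m : R -> R) (L : R) (u : R -> R) :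
  staircase m -> 0 <= L -> lipschitz_along m L u -> continuous u.
Proof.
move=> sm L0 hu; apply: (dist_le_continuous L0) => y z.
exact: lipschitz_along_dist sm L0 hu.
Qed.

Lemma staircase_continuous (R : realType) (m : R -> R) : staircase m -> continuous m.
Proof.
by move=> sm; apply: lipschitz_along_continuous ler01 (@lipschitz_along_self _ m).
Qed.

(** Affine functions of [m] in place of affine functions of the variable: the
graph is a triangle seen through [m]. *)
Lemma exists_tent (R : realType) (m : R -> R) (a d c : R) :
  staircase m -> m a < m d -> m d < m c ->
  exists L t T H, [/\ 0 <= L /\ lipschitz_along m L t, primitive T t,
    forall y, y <= a \/ c <= y -> t y = 0, t d = 1 &
    [/\ 0 < H, forall y, y <= a -> T y = 0 & forall y, c <= y -> T y = H]].
Proof.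
move=> sm mad mdc; have mono := @staircase_mono R m _ _ sm.
have ad : a < d by rewrite ltNge; apply/negP => /mono; rewrite leNgt mad.
have dc : d < c by rewrite ltNge; apply/negP => /mono; rewrite leNgt mdc.
pose p := (m d - m a)^-1; pose q := (m c - m d)^-1.
have p0 : 0 < p by rewrite invr_gt0 subr_gt0.
have q0 : 0 < q by rewrite invr_gt0 subr_gt0.
pose L := p + q.
pose t y := Num.max 0 (Num.min (0 + p * (m y + - m a * 1)) (0 + (- q) * (m y + - m c * 1))).
have L0 : 0 <= L by rewrite addr_ge0 ?ltW.
have cst0 (k : R) : lipschitz_along m 0 (fun=> k) := lipschitz_along_cst m k.
have tL : lipschitz_along m L t.
  have mk k : lipschitz_along m 1 (fun y => m y + - k * 1).
    by move=> y z; rewrite mul1r opprD addrACA subrr addr0.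
  apply: lipschitz_along_max.
    exact: lipschitz_alongW (cst0 0).
  apply: lipschitz_along_min; apply: (lipschitz_alongW _ (lipschitz_alongDZ _ (cst0 0) (mk _))).
    by rewrite add0r mulr1 gtr0_norm// lerDl ltW.
  by rewrite add0r mulr1 normrN gtr0_norm// lerDr ltW.
have t0 y : y <= a \/ c <= y -> t y = 0.
  move=> h; rewrite /t; apply/max_idPl; rewrite ge_min !add0r !mulr1.
  case: h => /mono h; apply/orP; [left|right].
    by rewrite pmulr_rle0// subr_le0.
  by rewrite mulNr oppr_le0 pmulr_rge0// subr_ge0.
have td : t d = 1.
  rewrite /t !add0r !mulr1 mulNr -mulrN opprB mulVf ?subr_eq0 ?gt_eqF//.
  by rewrite mulVf ?subr_eq0 ?gt_eqF// minxx; apply/max_idPr.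
have t_ge0 y : 0 <= t y by rewrite /t le_max lexx.
have [T PT T0] : exists2 T, primitive T t & forall y, y <= a -> T y = 0.
  apply: exists_primitive; last by move=> y ya; apply: t0; left.
  exact: lipschitz_along_continuous sm L0 tL.
exists L, t, T, (T c); split => //; split => //.
  have Tmono y z : y <= z -> T y <= T z.
    move=> yz; rewrite -subr_ge0; have [e _ ->] := primitive_MVT PT yz.
    by rewrite mulr_ge0// subr_ge0.
  (* [t] is [L]-Lipschitz, so it is at least 1/2 on [[d - s, d]]; this is why its
     integral is positive. *)
  pose s := (2 * (L + 1))^-1.
  have L1 : 0 < L + 1 by rewrite ltr_wpDl.
  have s0 : 0 < s by rewrite invr_gt0 mulr_gt0.
  have Ls : L * s < 1.
    by rewrite ltr_pdivrMr ?mulr_gt0// mul1r; lra.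
  have ds : d - s <= d by rewrite gerBl ltW.
  have [e /andP[e1 e2] E] := primitive_MVT PT ds.
  have te : 0 < t e.
    have := lipschitz_along_dist d e sm L0 tL; rewrite td (ger0_norm (x := d - e)) ?subr_ge0//.
    move=> /(le_trans (ler_norm _)) h.
    have : L * (d - e) <= L * s by rewrite ler_wpM2l//; lra.
    by lra.
  have Tds : 0 <= T (d - s).
    have [|h] := leP (d - s) a; first by move=> /T0 ->.
    by rewrite -(T0 a)// Tmono// ltW.
  apply: lt_le_trans (Tmono _ _ (ltW dc)).
  have : 0 < T d - T (d - s) by rewrite E mulr_gt0// opprB addrC subrK.
  by lra.
move=> y cy; apply/eqP; rewrite -subr_eq0.
have [e /andP[ce _] ->] := primitive_MVT PT cy.
by rewrite t0 ?mul0r//; right.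
Qed.

(** * Making values and slopes rational *)

Lemma exists_bump (R : realType) (m : R -> R) (a c : R) :
  staircase m -> m a < m c ->
  exists L t T H, [/\ 0 <= L /\ lipschitz_along m L t, primitive T t,
    forall y, y <= a \/ c <= y -> t y = 0 &
    [/\ 0 < H, forall y, y <= a -> T y = 0 & forall y, c <= y -> T y = H]].
Proof.
move=> sm mac.
have ac : a <= c by case: (leP a c) => // /ltW /(staircase_mono sm); rewrite leNgt mac.
have [] := @IVT R m a c ((m a + m c) / 2) ac.
- by apply: continuous_subspaceT; apply: staircase_continuous.
- by rewrite (min_idPl (ltW mac)) (max_idPr (ltW mac)); apply/andP; split; lra.
move=> d _ md; have [||L [t [T [H [hL PT t0 _ hH]]]]] := @exists_tent R m a d c sm.
- by rewrite md; lra.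
- by rewrite md; lra.
by exists L, t, T, H.
Qed.

(** Both [v] and its primitive vanish outside [[a, c]], so that adding them changes
neither slopes nor values outside that interval. *)
Definition local_perturbation (R : realType) (m : R -> R) (a c L : R) (v V : R -> R) :=
  [/\ 0 <= L, lipschitz_along m L v, primitive V v &
      forall y, y <= a \/ c <= y -> v y = 0 /\ V y = 0].

(** The difference of a bump left of [d] and a bump right of [d], both normalized to
have integral one. *)
Lemma exists_value_perturbation (R : realType) (m : R -> R) (a d c : R) :
  staircase m -> a <= d <= c -> m a < m d -> m d < m c ->
  exists L w W, [/\ local_perturbation m a c L w W, w d = 0 & W d = 1].
Proof.
move=> sm /andP[ad dc] mad mdc.
have [L1 [t1 [T1 [H1 [[L10 l1] P1 t10 [H10 T1l T1r]]]]]] := exists_bump sm mad.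
have [L2 [t2 [T2 [H2 [[L20 l2] P2 t20 [H20 T2l T2r]]]]]] := exists_bump sm mdc.
have P0 : primitive (fun=> 0) (fun=> 0 : R) := fun y => is_derive_cst (0 : R) y (1 : R).
have l0 := @lipschitz_along_cst R m 0.
have H1V : H1^-1 * H1 = 1 by rewrite mulVf// gt_eqF.
have H2V : H2^-1 * H2 = 1 by rewrite mulVf// gt_eqF.
exists (0 + `|H1^-1| * L1 + `|- H2^-1| * L2),
  (fun y => 0 + H1^-1 * t1 y + - H2^-1 * t2 y),
  (fun y => 0 + H1^-1 * T1 y + - H2^-1 * T2 y); split.
- split.
  + by rewrite !addr_ge0// mulr_ge0.
  + exact: (lipschitz_alongDZ _ (lipschitz_alongDZ _ l0 l1) l2).
  + exact: (primitiveDZ _ (primitiveDZ _ P0 P1) P2).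
  move=> y [ya|cy].
    have yd := le_trans ya ad.
    by rewrite t10 ?t20 ?T1l ?T2l//; [split; ring|left|left].
  have dy := le_trans dc cy.
  rewrite t10 ?t20 ?T1r ?T2r//; [|by right|by right].
  by split; [ring|rewrite mulNr H1V H2V; ring].
- by rewrite t10 ?t20//; [ring|left|right].
- by rewrite T1r// T2l// H1V; ring.
Qed.

(** A tent at [d], from which a multiple of a bump left of [d] is subtracted to
bring the total integral to zero. *)
Lemma exists_slope_perturbation (R : realType) (m : R -> R) (a d c : R) :
  staircase m -> a <= d <= c -> m a < m d -> m d < m c ->
  exists L v V, local_perturbation m a c L v V /\ v d = 1.
Proof.
move=> sm /andP[ad dc] mad mdc.
have [L1 [t1 [T1 [H1 [[L10 l1] P1 t10 [H10 T1l T1r]]]]]] := exists_bump sm mad.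
have [L2 [t2 [T2 [H2 [[L20 l2] P2 t20 td [H20 T2l T2r]]]]]] := exists_tent sm mad mdc.
exists (L2 + `|- (H2 / H1)| * L1),
  (fun y => t2 y + - (H2 / H1) * t1 y),
  (fun y => T2 y + - (H2 / H1) * T1 y); split.
- split.
  + by rewrite !addr_ge0// mulr_ge0.
  + exact: lipschitz_alongDZ.
  + exact: primitiveDZ.
  move=> y [ya|cy].
    have yd := le_trans ya ad.
    by rewrite t10 ?t20 ?T1l ?T2l//; [split; ring|left|left].
  have dy := le_trans dc cy.
  rewrite t10 ?t20 ?T1r ?T2r//; [|by right|by right].
  by split; [ring|rewrite mulNr divfK ?gt_eqF// subrr].
- by rewrite t10 ?td; [ring|right].
Qed.

Lemma exists_rational_shift (R : realType) (x e : R) : 0 < e ->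
  exists k, `|k| <= e /\ exists r : rat, x + k = ratr r.
Proof.
move=> e0; have [|r] := @rat_in_itvoo R x (x + e); first by rewrite ltrDl.
rewrite in_itv /= => /andP[h1 h2]; exists (ratr r - x); split.
  by rewrite gtr0_norm ?subr_gt0//; lra.
by exists r; rewrite addrC subrK.
Qed.

Definition rational_at (R : realType) (u U : R -> R) (d : rat) : Prop :=
  exists a c : rat, u (ratr d) = ratr a /\ U (ratr d) = ratr c.

(** By monotonicity [m] is constant on the whole interval between the two points. *)
Lemma flat_primitive (R : realType) (m u U : R -> R) (L y z : R) :
  staircase m -> lipschitz_along m L u -> primitive U u -> m y = m z ->
  u y = u z /\ U y = U z + u z * (y - z).
Proof.
move=> sm lu PU myz.
have flat x : m x = m z -> u x = u z.
  move=> mx; apply/eqP; rewrite -subr_eq0 -normr_le0.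
  by apply: le_trans (lu _ _) _; rewrite mx subrr normr0 mulr0.
split; first exact: flat.
case: (leP z y) => [zy|/ltW yz].
  have [x /andP[x1 x2] E] := primitive_MVT PU zy.
  rewrite -(flat x) -?E; first by ring.
  by apply/eqP; rewrite eq_le -{1}myz !(staircase_mono sm).
have [x /andP[x1 x2] E] := primitive_MVT PU yz.
rewrite -(flat x); first by rewrite -[y - z]opprB mulrN -E; ring.
by apply/eqP; rewrite eq_le -{2}myz !(staircase_mono sm).
Qed.

Lemma rational_at_flat (R : realType) (m u U : R -> R) (L : R) (d e : rat) :
  lipschitz_along m L u -> primitive U u -> staircase m ->
  m (ratr d) = m (ratr e) -> rational_at u U d -> rational_at u U e.
Proof.
move=> lu PU sm mde [a [c [ua Uc]]].
have [ue Ue] := flat_primitive sm lu PU (esym mde).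
exists a, (c + a * (e - d)); rewrite ue Ue ua Uc.
by rewrite rmorphD rmorphM rmorphB.
Qed.

Lemma exists_neighbours (s : seq rat) (d : rat) :
  0 \in s -> 1 \in s -> 0 <= d <= 1 -> d \notin s ->
  exists a c, [/\ a \in s, c \in s, a < d < c &
    forall z, z \in s -> z <= a \/ c <= z].
Proof.
move=> s0 s1 /andP[d0 d1] ds.
have lo : forall t : seq rat, {subset t <= s} ->
    exists2 a, (a \in s) && (a < d) & forall z, z \in t -> z < d -> z <= a.
  elim=> [_|x t IH ts].
    exists 0 => //; rewrite s0 lt_neqAle d0 andbT.
    by apply: contraNneq ds => <-.
  have [y yt|a /andP[as_ ad] Ha] := IH; first by apply: ts; rewrite inE yt orbT.
  have [h|h] := boolP (a < x < d).
    exists x; first by rewrite ts ?mem_head//; case/andP: h.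
    case/andP: h => ax _ z; rewrite inE => /orP[/eqP->//|zt zd].
    by apply: le_trans (Ha _ zt zd) (ltW ax).
  exists a; first by rewrite as_.
  move=> z; rewrite inE => /orP[/eqP-> xd|]; last exact: Ha.
  by move: h; rewrite xd andbT -leNgt.
have hi : forall t : seq rat, {subset t <= s} ->
    exists2 c, (c \in s) && (d < c) & forall z, z \in t -> d < z -> c <= z.
  elim=> [_|x t IH ts].
    exists 1 => //; rewrite s1 lt_neqAle d1 andbT.
    by apply: contraNneq ds => ->.
  have [y yt|a /andP[as_ ad] Ha] := IH; first by apply: ts; rewrite inE yt orbT.
  have [h|h] := boolP (d < x < a).
    exists x; first by rewrite ts ?mem_head//; case/andP: h.
    case/andP: h => _ ax z; rewrite inE => /orP[/eqP->//|zt zd].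
    by apply: le_trans (ltW ax) (Ha _ zt zd).
  exists a; first by rewrite as_.
  move=> z; rewrite inE => /orP[/eqP-> xd|]; last exact: Ha.
  by move: h; rewrite xd /= -leNgt.
have [a /andP[as_ ad] Ha] := lo s (fun _ => id).
have [c /andP[cs cd] Hc] := hi s (fun _ => id).
exists a, c; split => //; first by rewrite ad.
move=> z zs; case: (ltgtP z d) => [zd|dz|E]; [left|right|].
- exact: Ha.
- exact: Hc.
by rewrite -E zs in ds.
Qed.

(** If [m] is constant between [d] and one of its neighbours among the treated
points, then the graph of [U] is there a line with rational data and nothing has
to be done.  Otherwise first the slope at [d] is made rational, which disturbs the
value, and then the value, without disturbing the slope. *)
Lemma rational_step (R : realType) (m : R -> R) (L e : R) (u U : R -> R)
    (s : seq rat) (d : rat) :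
  staircase m -> lipschitz_along m L u -> primitive U u -> 0 < e ->
  0 \in s -> 1 \in s -> (forall z, z \in s -> rational_at u U z) ->
  exists v V, [/\ lipschitz_along m e v, primitive V v,
    forall z, z \in s -> v (ratr z) = 0 /\ V (ratr z) = 0,
    forall y, y <= 0 \/ 1 <= y -> v y = 0 /\ V y = 0 &
    0 <= d <= 1 -> rational_at (fun y => u y + v y) (fun y => U y + V y) d].
Proof.
move=> sm lu PU e0 s0 s1 gs.
have triv : rational_at u U d \/ ~~ (0 <= d <= 1) ->
  exists v V, [/\ lipschitz_along m e v, primitive V v,
    forall z, z \in s -> v (ratr z) = 0 /\ V (ratr z) = 0,
    forall y, y <= 0 \/ 1 <= y -> v y = 0 /\ V y = 0 &
    0 <= d <= 1 -> rational_at (fun y => u y + v y) (fun y => U y + V y) d].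
  move=> gd; exists (fun=> 0), (fun=> 0); split => //.
  - exact: (lipschitz_alongW (ltW e0) (@lipschitz_along_cst R m 0)).
  - by move=> y; apply: is_derive_cst.
  - move=> d01; case: gd => [[a [c [ua Uc]]]|]; last by rewrite d01.
    by exists a, c; rewrite !addr0.
have [d01|d01] : (0 <= d <= 1) \/ ~~ (0 <= d <= 1) by apply/orP; rewrite orbN.
  2: by apply: triv; right.
have [/gs gd|ds] := boolP (d \in s); first by apply: triv; left.
have [a [c [as_ cs /andP[ad dc] nb]]] := exists_neighbours s0 s1 d01 ds.
have ad' : (ratr a : R) <= ratr d by rewrite ler_rat ltW.
have dc' : (ratr d : R) <= ratr c by rewrite ler_rat ltW.
have := staircase_mono sm ad'; rewrite le_eqVlt => /orP[/eqP mad|mad].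
  by apply: triv; left; apply: rational_at_flat lu PU sm mad (gs _ as_).
have := staircase_mono sm dc'; rewrite le_eqVlt => /orP[/eqP mdc|mdc].
  by apply: triv; left; apply: rational_at_flat lu PU sm (esym mdc) (gs _ cs).
have adc : (ratr a : R) <= (ratr d : R) <= (ratr c : R) by apply/andP; split.
have [L1 [v [V [[L10 l1 P1 o1] vd]]]] := exists_slope_perturbation sm adc mad mdc.
have [L2 [w [W [[L20 l2 P2 o2] wd Wd]]]] := exists_value_perturbation sm adc mad mdc.
(* Multiples small enough for each perturbation to use half of the budget [e]. *)
pose e1 := e / 2 / (L1 + 1); pose e2 := e / 2 / (L2 + 1).
have L11 : 0 < L1 + 1 by rewrite ltr_wpDl.
have L21 : 0 < L2 + 1 by rewrite ltr_wpDl.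
have e10 : 0 < e1 by apply: divr_gt0 => //; apply: divr_gt0.
have e20 : 0 < e2 by apply: divr_gt0 => //; apply: divr_gt0.
have [p [pe [ra Ea]]] := exists_rational_shift (u (ratr d)) e10.
have [q [qe [rc Ec]]] := exists_rational_shift (U (ratr d) + p * V (ratr d)) e20.
have out y : y <= ratr a \/ ratr c <= y ->
    0 + p * v y + q * w y = 0 /\ 0 + p * V y + q * W y = 0.
  by move=> h; have [-> ->] := o1 _ h; have [-> ->] := o2 _ h; split; ring.
have P0 : primitive (fun=> 0) (fun=> 0 : R) := fun y => is_derive_cst (0 : R) y (1 : R).
have l0 := @lipschitz_along_cst R m 0.
exists (fun y => 0 + p * v y + q * w y), (fun y => 0 + p * V y + q * W y); split.
- apply: (lipschitz_alongW _ (lipschitz_alongDZ _ (lipschitz_alongDZ _ l0 l1) l2)).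
  have h1 : `|p| * L1 <= e / 2.
    apply: (@le_trans _ _ (e1 * (L1 + 1))); last by rewrite /e1 divfK ?gt_eqF.
    by rewrite ler_pM// lerDl.
  have h2 : `|q| * L2 <= e / 2.
    apply: (@le_trans _ _ (e2 * (L2 + 1))); last by rewrite /e2 divfK ?gt_eqF.
    by rewrite ler_pM// lerDl.
  by lra.
- exact: (primitiveDZ _ (primitiveDZ _ P0 P1) P2).
- by move=> z /nb h; apply: out; rewrite !ler_rat.
- have /andP[d0 d1] := d01.
  have a0 : 0 <= a by case: (nb _ s0) => // h; lra.
  have c1 : c <= 1 by case: (nb _ s1) => // h; lra.
  have a0' : (0 : R) <= ratr a by rewrite -(rmorph0 (@ratr R)) ler_rat.
  have c1' : (ratr c : R) <= 1 by rewrite -(rmorph1 (@ratr R)) ler_rat.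
  by move=> y [y0|y1]; apply: out; [left; apply: le_trans y0 a0'|right; apply: le_trans c1' y1].
- by move=> _; exists ra, rc; rewrite vd wd Wd; split; [rewrite -Ea|rewrite -Ec]; ring.
Qed.

(** * Passage to the limit *)

Lemma le_geometric_gap (R : realType) (x y K : R) :
  (forall n, x <= y + K / 2 ^+ n) -> x <= y.
Proof.
move=> H; rewrite leNgt; apply/negP => yx.
have d0 : 0 < x - y by rewrite subr_gt0.
pose n := (Num.truncn (K / (x - y))).+1.
have n1 : K < n%:R * (x - y) by rewrite -ltr_pdivrMr// truncnS_gt.
have n2 : (n%:R : R) <= 2 ^+ n by rewrite -natrX ler_nat ltnW// ltn_expl.
have p0 : (0 : R) < 2 ^+ n by rewrite exprn_gt0.
have := H n; rewrite -lerBlDl ler_pdivlMr// => h.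
have : n%:R * (x - y) <= (x - y) * 2 ^+ n by rewrite mulrC ler_pM2l.
by move: n1 h; rewrite -/n; lra.
Qed.

(** The sequences [x n - 2 * K / 2 ^+ n] and [x n + 2 * K / 2 ^+ n] are monotone and
enclose the limit. *)
Lemma exists_geometric_limit (R : realType) (x : nat -> R) (K : R) :
  (forall n, `|x n.+1 - x n| <= K / 2 ^+ n) ->
  exists l, forall n, `|l - x n| <= 2 * K / 2 ^+ n.
Proof.
move=> H; have K0 : 0 <= K by have := le_trans (normr_ge0 _) (H 0%N); rewrite expr0 divr1.
have half n : 2 * K / 2 ^+ n.+1 = K / 2 ^+ n.
  by rewrite exprS invfM mulrA -[2 * K / 2]mulrAC divff ?mul1r// pnatr_eq0.
have dbl n : 2 * K / 2 ^+ n = K / 2 ^+ n + K / 2 ^+ n by rewrite -mulrA mulr_natl mulr2n.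
pose a n := x n - 2 * K / 2 ^+ n; pose b n := x n + 2 * K / 2 ^+ n.
have aS n : a n <= a n.+1.
  have := H n; rewrite ler_norml /a half dbl => /andP[? ?]; lra.
have bS n : b n.+1 <= b n.
  have := H n; rewrite ler_norml /b half dbl => /andP[? ?]; lra.
have am n k : a n <= a (n + k)%N.
  by elim: k => [|k IH]; rewrite ?addn0// addnS (le_trans IH).
have bm n k : b (n + k)%N <= b n.
  by elim: k => [|k IH]; rewrite ?addn0// addnS (le_trans _ IH).
have ab n : a n <= b n.
  have : 0 <= 2 * K / 2 ^+ n by rewrite divr_ge0 ?mulr_ge0 ?exprn_ge0.
  by rewrite /a /b; lra.
have abnk n k : a k <= b n.
  by apply: le_trans (am k n) _; apply: le_trans (bm n k); rewrite addnC.
exists (sup (range a)) => n; rewrite ler_norml.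
have h1 : a n <= sup (range a).
  by apply: sup_upper_bound => //; split; [exists (a 0%N), 0%N|exists (b 0%N) => _ [k _ <-]].
have h2 : sup (range a) <= b n.
  by apply: sup_le_ub; [exists (a 0%N), 0%N|move=> _ [k _ <-]].
by move: h1 h2; rewrite /a /b => h1 h2; apply/andP; split; lra.
Qed.

Definition rat_enum (n : nat) : rat := odflt (0 : rat) (unpickle n).

Definition nodes (n : nat) : seq rat :=
  [:: 0, 1 & [seq q <- [seq rat_enum i | i <- iota 0 n] | 0 <= q <= 1]].

Lemma nodesS (n : nat) (z : rat) : z \in nodes n.+1 ->
  z \in nodes n \/ z = rat_enum n /\ 0 <= z <= 1.
Proof.
rewrite /nodes -addn1 iotaD map_cat filter_cat !inE mem_cat => /or4P[->|->|->|].
- by left.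
- by left; rewrite orbT.
- by left; rewrite !orbT.
by rewrite mem_filter /= inE add0n => /andP[h /eqP E]; right.
Qed.

Lemma nodes_mono (n k : nat) (z : rat) : (n <= k)%N -> z \in nodes n -> z \in nodes k.
Proof.
move=> nk; rewrite /nodes -(subnKC nk) iotaD map_cat filter_cat !inE mem_cat.
by case/or3P => ->; rewrite ?orbT.
Qed.

Lemma mem_nodes (z : rat) : 0 <= z <= 1 -> exists n, z \in nodes n.
Proof.
move=> z01; exists (pickle z).+1; rewrite /nodes 2!in_cons mem_filter z01 andTb.
apply/orP; right; apply/orP; right; apply/mapP; exists (pickle z).
  by rewrite mem_iota leq0n add0n ltnSn.
by rewrite /rat_enum pickleK.
Qed.

(** A multiple of a bump.  Its integral over [[0, 1]] is a nonzero rational, which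
already prevents the final map from being affine, as no later perturbation
changes it. *)
Lemma exists_initial_profile (R : realType) (m : R -> R) :
  staircase m -> m 0 < m 1 ->
  exists u U (r : rat), [/\ lipschitz_along m 4^-1 u, primitive U u,
    forall y, y <= 0 \/ 1 <= y -> u y = 0, forall y, y <= 0 -> U y = 0 &
    U 1 = ratr r /\ r != 0].
Proof.
move=> sm m01; have [L [t [T [H [[L0 lt] PT t0 [H0 Tl Tr]]]]]] := exists_bump sm m01.
(* The multiple is [r / H]: it gives integral [r] and constant [r / H * L <= 1/4]. *)
have [|r] := @rat_in_itvoo R 0 (H / (4 * (L + 1))).
  by rewrite divr_gt0// mulr_gt0// ltr_wpDl.
rewrite in_itv /= => /andP[r0 rH].
have P0 : primitive (fun=> 0) (fun=> 0 : R) := fun y => is_derive_cst (0 : R) y (1 : R).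
exists (fun y => 0 + ratr r / H * t y), (fun y => 0 + ratr r / H * T y), r; split.
- apply: lipschitz_alongW (lipschitz_alongDZ _ (@lipschitz_along_cst R m 0) lt).
  have g0 : 0 < ratr r / H by apply: divr_gt0.
  rewrite add0r (gtr0_norm g0) mulrAC ler_pdivrMr//.
  move: rH; rewrite ltr_pdivlMr ?mulr_gt0 ?ltr_wpDl// => rH.
  by nra.
- exact: primitiveDZ.
- by move=> y h; rewrite t0// mulr0 addr0.
- by move=> y h; rewrite Tl// mulr0 addr0.
- have r0' : 0 < r by rewrite -(ltr0q R).
  by split; [rewrite Tr// add0r divfK// gt_eqF|rewrite gt_eqF].
Qed.

(** The perturbations of size [1/8, 1/16, ...] keep the constant along [m] at most
[1/4 + 1/4], and no point is disturbed once it has been treated, so its values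
pass to the limit. *)
Theorem exists_rational_profile (R : realType) (m : R -> R) :
  staircase m -> m 0 < m 1 ->
  exists u U (r : rat), [/\ lipschitz_along m 2^-1 u, primitive U u,
    forall y, y <= 0 \/ 1 <= y -> u y = 0,
    U 0 = 0 /\ (U 1 = ratr r /\ r != 0) &
    forall d : rat, 0 <= d <= 1 -> rational_at u U d].
Proof.
move=> sm m01; have [u0 [U0 [r [l0 P0 o0 Ul0 [Ur0 r_neq0]]]]] := exists_initial_profile sm m01.
pose state := ((R -> R) * (R -> R))%type.
pose eps n : R := 8^-1 / 2 ^+ n.
have eps0 n : 0 < eps n by rewrite divr_gt0// exprn_gt0.
(* [lip] starts at 1/4 and increases by [eps] at each step. *)
pose lip n : R := 2^-1 - 4^-1 / 2 ^+ n.
have lipS n : lip n + eps n = lip n.+1.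
  by rewrite /lip /eps exprS; field; rewrite expf_neq0.
pose inv n (S : state) := [/\ lipschitz_along m (lip n) S.1, primitive S.2 S.1 &
  forall z, z \in nodes n -> rational_at S.1 S.2 z].
pose next n (S S' : state) := [/\ lipschitz_along m (eps n) (fun y => S'.1 y - S.1 y),
  forall z, z \in nodes n -> S'.1 (ratr z) = S.1 (ratr z) /\ S'.2 (ratr z) = S.2 (ratr z) &
  forall y, y <= 0 \/ 1 <= y -> S'.1 y = S.1 y].
have step (nS : nat * state) : exists S' : state, inv nS.1 nS.2 ->
    inv nS.1.+1 S' /\ next nS.1 nS.2 S'.
  case: nS => n S /=; have [[lS PS gS]|] := pselect (inv n S); last by exists S.
  have [|||v [V [lv Pv zv ov gv]]] :=
    @rational_step R m (lip n) (eps n) S.1 S.2 (nodes n) (rat_enum n) sm lS PS (eps0 n).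
  (* The end points 0 and 1 are nodes from the start, so neighbours always exist. *)
  - exact: mem_head.
  - by rewrite !inE eqxx orbT.
  - exact: gS.
  exists (fun y => S.1 y + 1 * v y, fun y => S.2 y + 1 * V y) => _; split; split => /=.
  - apply: lipschitz_alongW (lipschitz_alongDZ _ lS lv).
    by rewrite normr1 mul1r lipS.
  - exact: primitiveDZ.
  - move=> z /nodesS[zn|[-> /gv]].
      have [a [c [Ea Ec]]] := gS _ zn; exists a, c.
      by have [-> ->] := zv _ zn; rewrite !mulr0 !addr0.
    by case=> a [c [Ea Ec]]; exists a, c; rewrite !mul1r.
  - by move=> y z; rewrite !mul1r ![_ + v _]addrC !addrK.
  - by move=> z zn; have [-> ->] := zv _ zn; rewrite !mulr0 !addr0.
  - by move=> y h; have [-> _] := ov _ h; rewrite mulr0 addr0.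
have [f Hf] := choice step.
pose S := fix S n : state := if n is n'.+1 then f (n', S n') else (u0, U0).
have Sinv n : inv n (S n).
  elim: n => [|n IH] /=; last by have [] := Hf (n, S n) IH.
  split => //=; first by apply: lipschitz_alongW l0; rewrite /lip expr0 divr1; lra.
  move=> z; rewrite /nodes /= !inE => /orP[] /eqP ->.
    by exists 0, 0; rewrite !rmorph0 o0 ?Ul0//; left.
  by exists 0, r; rewrite rmorph1 rmorph0 o0 ?Ur0//; right.
have Snext n : next n (S n) (S n.+1) by have [] := Hf (n, S n) (Sinv n).
have Sdist n y : `|(S n.+1).1 y - (S n).1 y| <= eps n.
  have [lS _ oS] := Snext n.
  have out : y <= 0 \/ 1 <= y -> `|(S n.+1).1 y - (S n).1 y| <= eps n.
    by move=> /oS ->; rewrite subrr normr0 ltW.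
  have [y0|y0] := leP y 0; first by apply: out; left.
  have [y1|y1] := leP 1 y; first by apply: out; right.
  have := lS y 0; rewrite (oS 0) ?subrr ?subr0; last by left.
  move/le_trans; apply; rewrite -[leRHS]mulr1 ler_pM2l//.
  by apply: le_trans (staircase_dist _ _ sm) _; rewrite subr0 gtr0_norm// ltW.
have [u Hu] := choice (fun y => exists_geometric_limit (fun n => Sdist n y)).
have {Hu} Hu y n : `|u y - (S n).1 y| <= 4^-1 / 2 ^+ n.
  by apply: le_trans (Hu y n) _; rewrite (_ : 2 * 8^-1 = 4^-1 :> R)//; field.
have Sout n y : y <= 0 \/ 1 <= y -> (S n).1 y = 0.
  by move=> h; elim: n => [|n IH]; [exact: o0|have [_ _ ->] := Snext n].
have uout y : y <= 0 \/ 1 <= y -> u y = 0.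
  move=> h; apply/eqP; rewrite -normr_le0; apply: (@le_geometric_gap R _ _ 4^-1) => n.
  by rewrite add0r; have := Hu y n; rewrite Sout// subr0.
have lu : lipschitz_along m 2^-1 u.
  move=> y z; apply: (@le_geometric_gap R _ _ 2^-1) => n.
  have [lS _ _] := Sinv n.
  have -> : u y - u z = (u y - (S n).1 y) + ((S n).1 y - (S n).1 z) - (u z - (S n).1 z).
    by ring.
  apply: le_trans (ler_normB _ _) _; apply: le_trans (lerD (ler_normD _ _) (lexx _)) _.
  have h1 := Hu y n; have h2 := Hu z n.
  have h3 : `|(S n).1 y - (S n).1 z| <= 2^-1 * `|m y - m z|.
    apply: le_trans (lS y z) _; rewrite ler_wpM2r// /lip gerBl divr_ge0// exprn_ge0//.
  have -> : 2^-1 / 2 ^+ n = 4^-1 / 2 ^+ n + 4^-1 / 2 ^+ n :> R.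
    by rewrite -mulrDl; congr (_ / _); field.
  by lra.
have [U PU U00] : exists2 U, primitive U u & forall y, y <= 0 -> U y = 0.
  apply: exists_primitive; last by move=> y y0; apply: uout; left.
  by apply: lipschitz_along_continuous lu.
have SU0 n : (S n).2 0 = 0.
  elim: n => [|n IH]; first exact: Ul0.
  by have [_ + _] := Snext n => /(_ 0 (mem_head _ _))[_]; rewrite rmorph0 => ->.
have Udist n y : 0 <= y <= 1 -> `|U y - (S n).2 y| <= 4^-1 / 2 ^+ n.
  move=> /andP[y0 y1]; have [_ PS _] := Sinv n.
  have [c _] := primitive_MVT (primitiveDZ (-1) PU PS) y0.
  rewrite /= SU0 (U00 0 (lexx _)) mulr0 addr0 !subr0 !mulN1r => ->.
  by rewrite normrM (ger0_norm y0) -[leRHS]mulr1 ler_pM.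
have Sconst n k z : z \in nodes n ->
    (S (n + k)%N).1 (ratr z) = (S n).1 (ratr z) /\ (S (n + k)%N).2 (ratr z) = (S n).2 (ratr z).
  move=> zn; elim: k => [|k [<- <-]]; first by rewrite addn0.
  rewrite addnS; have [_ h _] := Snext (n + k)%N.
  by apply: h; apply: nodes_mono zn; rewrite leq_addr.
have limE n z : z \in nodes n -> 0 <= z <= 1 ->
    u (ratr z) = (S n).1 (ratr z) /\ U (ratr z) = (S n).2 (ratr z).
  move=> zn /andP[z0 z1].
  have z01 : 0 <= (ratr z : R) <= 1.
    by rewrite -(rmorph0 (@ratr R)) -(rmorph1 (@ratr R)) !ler_rat z0.
  have small k : 4^-1 / 2 ^+ (n + k) <= 0 + 4^-1 / 2 ^+ k :> R.
    rewrite add0r ler_pM2l// lef_pV2 ?posrE ?exprn_gt0//.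
    by rewrite ler_weXn2l ?leq_addl// ler1n.
  split; apply/eqP; rewrite -subr_eq0 -normr_le0;
    apply: (@le_geometric_gap R _ _ 4^-1) => k; have [E1 E2] := Sconst n k z zn.
    by rewrite -E1; apply: le_trans (Hu _ _) (small k).
  by rewrite -E2; apply: le_trans (Udist _ _ z01) (small k).
exists u, U, r; split => //.
  split; first exact: U00.
  have n1 : 1 \in nodes 0 by rewrite /nodes /= !inE eqxx orbT.
  by have [_] := limE 0%N 1 n1 isT; rewrite rmorph1 => ->.
move=> d d01; have [n dn] := mem_nodes d01.
have [E1 E2] := limE n d dn d01; have [_ _ /(_ _ dn)[a [c [Ea Ec]]]] := Sinv n.
by exists a, c; rewrite E1 E2.
Qed.

(** * The diffeomorphism *)

Lemma C11_primitive (R : realType) (F g : R -> R) (K : R) :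
  primitive F g -> 0 <= K -> (forall y z, `|g y - g z| <= K * `|y - z|) ->
  C11 F /\ lipschitz F^`().
Proof.
move=> PF K0 gK.
have F'E : F^`() = g by apply/funext => y; rewrite derive1E; have [_ ->] := PF y.
have lg : lipschitz g.
  exists K; split; first exact: num_real.
  move=> M KM [y z] _ /=; apply: le_trans (gK y z) _.
  by rewrite ler_wpM2r// ltW.
rewrite /C11 F'E; split => //; split => //; first by move=> y; have [] := PF y.
exact: dist_le_continuous K0 gK.
Qed.

Lemma primitive_expanding (R : realType) (h g : R -> R) (y z : R) :
  primitive h g -> (forall c, 2^-1 <= g c) -> y <= z -> 2^-1 * (z - y) <= h z - h y.
Proof.
move=> Ph g2 yz; have [c _ ->] := primitive_MVT Ph yz.
by rewrite ler_wpM2r ?subr_ge0.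
Qed.

(** The derivative of [h] being at least 1/2 makes [h] expand distances by that
factor, which yields injectivity, surjectivity and the Lipschitz bound. *)
Lemma exists_inverse (R : realType) (h g : R -> R) :
  primitive h g -> (forall c, 2^-1 <= g c) ->
  exists f, [/\ cancel f h, cancel h f, {homo f : x y / x < y},
    forall x y, `|f x - f y| <= 2 * `|x - y| &
    primitive f (fun x => (g (f x))^-1)].
Proof.
move=> Ph g2; have ex := fun y z => @primitive_expanding R h g y z Ph g2.
have surj x : exists y, h y = x.
  pose b := 2 * `|x - h 0|.
  have b0 : 0 <= b by rewrite mulr_ge0.
  have [|||y _ hy] := @IVT R h (- b) b x; last by exists y.
  - by rewrite lerNl (le_trans _ b0)// oppr_le0.
  - by apply: continuous_subspaceT; apply: primitive_continuous Ph.
  - have := ex _ _ b0; have := ex (- b) 0; rewrite oppr_le0 => /(_ b0).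
    have := ler_norm (x - h 0); have := ler_norm (- (x - h 0)); rewrite normrN /b => *.
    by rewrite ge_min le_max; apply/andP; split; apply/orP; [left|right]; lra.
have [f fh] := choice surj.
have inj y z : h y = h z -> y = z.
  move=> E; case: (ltgtP y z) => // yz; have := ex _ _ (ltW yz); rewrite E subrr; lra.
have hf : cancel h f by move=> y; apply: inj.
have dist x y : `|f x - f y| <= 2 * `|x - y|.
  wlog le : x y / f x <= f y => [H|].
    by case: (leP (f x) (f y)) => [/H//|/ltW/H]; rewrite distrC [`|y - x|]distrC.
  have := ex _ _ le; rewrite !fh => h1.
  rewrite distrC ger0_norm ?subr_ge0// distrC.
  by have := ler_norm (y - x); lra.
exists f; split => //.
- move=> x y xy; rewrite ltNge; apply/negP => le.
  by have := ex _ _ le; rewrite !fh; lra.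
- move=> x; rewrite -{1}(fh x); apply: (@is_derive_inverse R h f (g (f x)) (f x)).
  + by exists 1 => //= y _; apply: hf.
  + by exists 1 => //= y _; apply: primitive_continuous Ph y.
  + exact: Ph.
  + by rewrite gt_eqF// (lt_le_trans _ (g2 _)).
Qed.

Theorem theorem1p4 (R : realType) :
  exists f finv : R -> R,
    [/\ cancel f finv /\ cancel finv f,
        C11 f /\ C11 finv,
        {homo f : x y / x < y},
        ~ affine f
      & [/\ forall b : nat, (2 <= b)%N ->
              f @` normal_numbers R b `<=` normal_numbers R b,
            f @` absolutely_normal_numbers R `<=` absolutely_normal_numbers R
          & lipschitz f^`() /\ lipschitz finv^`()]].
Proof.
pose N : set R := \bigcup_b
  (if (2 <= b)%N then [set x | 0 <= x < 1 /\ ~ normal_numbers R b x] else set0).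
have N0 : (@lebesgue_measure R).-negligible N.
  apply: negligible_bigcup => b; case: ifP => [b2|_]; last exact: negligible_set0.
  by apply: negligible_not_normal; apply: ltnW.
have [m [sm m0 m1 m01 mN]] := exists_staircase N0.
have [u [U [r [lu PU uout [U0 [U1 r0]] Urat]]]] := exists_rational_profile sm m01.
have u_dist y z : `|u y - u z| <= 2^-1 * `|y - z| by apply: lipschitz_along_dist lu.
have u_le y : `|u y| <= 2^-1.
  have [y0|y0] := leP y 0; first by rewrite uout ?normr0//; left.
  have [y1|y1] := leP 1 y; first by rewrite uout ?normr0//; right.
  have := u_dist y 0; rewrite (uout 0); last by left.
  by rewrite !subr0 (gtr0_norm y0); lra.
pose h y := y + 1 * U y; pose g y := 1 + 1 * u y.
have Ph : primitive h g.
  by apply: primitiveDZ => // y; apply: is_derive_id.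
have g2 c : 2^-1 <= g c.
  by have := u_le c; rewrite ler_norml /g => /andP[? _]; lra.
have g_dist y z : `|g y - g z| <= 2^-1 * `|y - z|.
  by rewrite /g !mul1r opprD addrACA subrr add0r.
have [f [fh hf f_mono f_dist Pf]] := exists_inverse Ph g2.
have f'_dist x y : `|(g (f x))^-1 - (g (f y))^-1| <= 4 * `|x - y|.
  have gp c : 0 < g c by apply: lt_le_trans (g2 c).
  have -> : (g (f x))^-1 - (g (f y))^-1 = (g (f y) - g (f x)) / (g (f x) * g (f y)).
    by field; rewrite !gt_eqF.
  have gg : 4^-1 <= g (f x) * g (f y).
    have -> : 4^-1 = 2^-1 * 2^-1 :> R by rewrite -invfM -natrM.
    by apply: ler_pM.
  rewrite normrM normfV (gtr0_norm (mulr_gt0 _ _))// ler_pdivrMr ?mulr_gt0//.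
  have := g_dist (f y) (f x); have := f_dist y x; rewrite [`|y - x|]distrC => h1 h2.
  have : 4 * `|x - y| * 4^-1 <= 4 * `|x - y| * (g (f x) * g (f y)).
    by rewrite ler_wpM2l// mulr_ge0.
  by lra.
have half0 : (0 : R) <= 2^-1 by rewrite invr_ge0.
have [C11h liph] := C11_primitive Ph half0 g_dist.
have [C11f lipf] := C11_primitive Pf (ler0n R 4) f'_dist.
have preserve b : (2 <= b)%N -> f @` normal_numbers R b `<=` normal_numbers R b.
  move=> b2 _ [x nx <-]; apply: contrapT => nfx; set y := f x in nfx *.
  (* When [y] lies in [[0, 1]] outside the set carrying [m], any rational close
     enough to [y] will do; to the left of 0 and to the right of 1, [m] is constant. *)
  have [d [d01 md]] : exists d : rat, 0 <= d <= 1 /\ m y = m (ratr d).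
    have [y0|y0] := leP y 0; first by exists 0; rewrite rmorph0 m0.
    have [y1|y1] := leP 1 y; first by exists 1; rewrite rmorph1 m1.
    have Ny : N y by exists b => //; rewrite b2 /= (ltW y0).
    have /nbhs_ballP[e /= e0 He] := mN y Ny.
    have [|d] := @rat_in_itvoo R y (Num.min (y + e) 1).
      by rewrite lt_min ltrDl e0.
    rewrite in_itv /= lt_min => /and3P[d1 d2 d3]; exists d; split.
      rewrite -(ler0q R) -(ler_rat R) rmorph1.
      by apply/andP; split; apply: ltW => //; apply: lt_trans d1.
    by apply/esym/He; rewrite /ball /= distrC gtr0_norm ?subr_gt0//; lra.
  have [a [c [ua Uc]]] := Urat d d01.
  have [uy Uy] := flat_primitive sm lu PU md.
  apply: nfx; apply: (@normal_affine R b x y (1 + a) (c - a * d)) nx.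
  - exact: ltnW.
  - have := g2 (ratr d); rewrite /g ua mul1r => ga.
    by rewrite -(ltr0q R) rmorphD rmorph1; lra.
  - rewrite -(fh x) -/y /h Uy ua Uc rmorphD rmorphB rmorphM rmorph1 /=; ring.
exists f, h; split => //.
- move=> [a [c fE]].
  have h0 : h 0 = 0 by rewrite /h U0; ring.
  have h1 : h 1 = 1 + ratr r by rewrite /h U1; ring.
  (* Off [[0, 1]] the map is a translation: [f (- 1) = - 1] and [f 0 = 0] force the
     slope one, which [f (1 + r) = 1] contradicts. *)
  have hN : h (-1) = -1.
    have [e /andP[_ e0]] := primitive_MVT PU (lerN10 R).
    by rewrite uout ?mul0r ?U0; [rewrite /h => ?; lra|left].
  have := hf 0; have := hf 1; have := hf (-1); rewrite h0 h1 hN !fE => E1 E2 E3.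
  have r0' : ratr r != 0 :> R by rewrite fmorph_eq0.
  by apply/negP: r0'; rewrite negbK; apply/eqP; nra.
- split => // _ [x nx <-] b b2; apply: preserve => //.
  by exists x => //; apply: nx.
Qed.
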